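(* Let $p\ge 2$ be an integer. Let $(c_n)_{n\ge0}$ be a sequence of integers satisfying a linear recursion of the form $$c_n=a_1c_{n-1}+a_2c_{n-2}+\cdots+a_Lc_{n-L},\qquad n>L,$$ for some $L\ge1$ and integer coefficients $a_1,\dots,a_L$ with $a_L\neq0$. If the integers $a_L$ and $p$ are relatively prime, then the set $$G_{p,(c_n)}=\bigl\{\mu\in\mathcal{P}_{p,c}(\mathbb{T})\;:\;T_{c_n}\mu\text{ does not converge } w^*\text{ to }\mathrm{Leb}\text{ as }n\to+\infty\bigr\}$$ is residual in $(\mathcal{P}_p(\mathbb{T}),w^* )$.
   Context: $\mathbb{T}=\mathbb{R}/\mathbb{Z}$ is the circle group. For an integer $m$, $T_m:\mathbb{T}\to\mathbb{T}$ is $x\mapsto mx \bmod 1$, and $T_m\mu$ is the push-forward measure $T_m\mu(C)=\mu(T_m^{-1}C)$. $\mathcal{P}(\mathbb{T})$ is the set of Borel probability measures on $\mathbb{T}$ with the topology of $w^*$-convergence ($\mu_k\to\mu$ iff $\int f\,d\mu_k\to\int f\,d\mu$ for all continuous $f$ on $\mathbb{T}$). $\mathcal{P}_p(\mathbb{T})$ is the set of $\mu\in\mathcal{P}(\mathbb{T})$ with $T_p\mu=\mu$, with the induced topology (a compact metrizable space), and $\mathcal{P}_{p,c}(\mathbb{T})$ is the set of those $\mu\in\mathcal{P}_p(\mathbb{T})$ which have no atom. $\mathrm{Leb}$ is the normalised Lebesgue measure on $\mathbb{T}$. A subset of a Polish space is residual if it contains a dense $G_\delta$ set. *)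

(* Defs.v *)
From HB Require Import structures.
From mathcomp Require Import all_boot all_order all_algebra.
From mathcomp Require Import all_classical all_reals all_analysis.
From mathcomp Require Import borel_hierarchy.

Set Implicit Arguments.
Unset Strict Implicit.
Unset Printing Implicit Defensive.

Import Order.TTheory GRing.Theory Num.Theory.
Import numFieldNormedType.Exports.

Local Open Scope classical_set_scope.
Local Open Scope quotient_scope.
Local Open Scope ring_scope.

(* [Num.int_num_subdef] is the boolean predicate underlying [Num.int]; the
   library names the quotient by an additive subgroup [ideal_quot] even though
   no ideal structure is involved. *)
Definition circle_group (R : realType) : Type :=
  {ideal_quot (GRing.ZmodClosed.clone R (@Num.int_num_subdef R) _)}.

HB.instance Definition _ (R : realType) := GRing.Zmodule.on (circle_group R).
HB.instance Definition _ (R : realType) := Quotient.on (circle_group R).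

Definition circle (R : realType) : Type := quotient_topology (circle_group R).

HB.instance Definition _ (R : realType) :=
  Quotient.copy (circle R) (quotient_topology (circle_group R)).
HB.instance Definition _ (R : realType) :=
  PointedTopological.copy (circle R) (quotient_topology (circle_group R)).
HB.instance Definition _ (R : realType) :=
  GRing.Zmodule.copy (circle R) (circle_group R).
HB.instance Definition _ (R : realType) :=
  Measurable.copy (circle R) (g_sigma_algebraType (@open (circle R))).

Section circle_maps.
Context {R : realType}.

Definition circle_proj (x : measurableTypeR R) : circle R := \pi_(circle R) x.

Definition circle_mul (m : int) (x : circle R) : circle R := x *~ m.

Lemma circle_projB (x y : R) :
  circle_proj (x - y) = circle_proj x - circle_proj y.
Proof.
exact: (pi_is_zmod_morphism
  {ideal_quot (GRing.ZmodClosed.clone R (@Num.int_num_subdef R) _)}).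
Qed.

Lemma circle_proj_eq (x y : R) :
  circle_proj x = circle_proj y <-> x - y \is a Num.int.
Proof.
have e := ring_quotient.Quotient.idealrBE
  (GRing.ZmodClosed.clone R (@Num.int_num_subdef R) _) x y.
by split=> [xy|]; [apply: etrans e _; exact/eqP | move/(etrans (esym e))/eqP].
Qed.

Lemma circle_proj_continuous : continuous (circle_proj : R -> circle R).
Proof. exact: pi_continuous. Qed.

Lemma circle_mul_proj (m : int) (x : R) :
  circle_mul m (circle_proj x) = circle_proj (x *~ m).
Proof.
pose f := GRing.isZmodMorphism.Build R (circle R) circle_proj circle_projB.
pose g : {additive R -> circle R} := HB.pack circle_proj f.
by rewrite /circle_mul -[circle_proj]/(g : R -> circle R) raddfMz.
Qed.

Lemma circle_mul_continuous (m : int) : continuous (circle_mul m).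
Proof.
apply/(@quotient_continuous R (circle_group R)).
rewrite (_ : _ \o _ = circle_proj \o (fun x : R => m%:~R * x)); last first.
  by apply/funext => x /=; rewrite mulrzl -circle_mul_proj.
move=> x; apply: continuous_comp; last exact: circle_proj_continuous.
exact: mulrl_continuous.
Qed.

Lemma circle_proj_measurable : measurable_fun setT circle_proj.
Proof.
apply: (measurability (@open (circle R))) => //.
move=> _ [A oA <-]; rewrite setTI.
by apply: measurable_realfun.open_measurable; move/continuousP: circle_proj_continuous; apply.
Qed.

Lemma circle_mul_measurable (m : int) : measurable_fun setT (circle_mul m).
Proof.
apply: (measurability (@open (circle R))) => //.
move=> _ [A oA <-]; rewrite setTI; apply: sub_gen_smallest.
by move/continuousP: (@circle_mul_continuous m); apply.
Qed.

HB.instance Definition _ :=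
  isMeasurableFun.Build _ _ _ _ circle_proj circle_proj_measurable.
HB.instance Definition _ (m : int) :=
  isMeasurableFun.Build _ _ _ _ (circle_mul m) (@circle_mul_measurable m).

End circle_maps.

Definition circle_prob (R : realType) : Type := probability (circle R) R.

HB.instance Definition _ (R : realType) := Pointed.on (circle_prob R).

Section circle_probabilities.
Context {R : realType}.

Definition times_push (m : int) (mu : circle_prob R) : circle_prob R :=
  distribution mu (circle_mul m).

Definition circle_leb : circle_prob R :=
  distribution (uniform_prob (@ltr01 R)) circle_proj.

Definition integral_map (mu : circle_prob R) :
    {ptws continuousType (circle R) R -> R} :=
  fun f => \int[mu]_x f x.

End circle_probabilities.

(* The w*-topology: the coarsest one making integration of each continuous
   function continuous. *)
HB.instance Definition _ (R : realType) :=
  PointedTopological.copy (circle_prob R) (initial_topology (@integral_map R)).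

Section wstar_theory.
Context {R : realType}.
Implicit Types mu nu : circle_prob R.

Lemma cvg_initialP (S : choiceType) (T : topologicalType) (f : S -> T)
    (F : set_system S) (s : S) : Filter F ->
  F --> (s : initial_topology f) <-> f @ F --> f s.
Proof.
move=> FF; split=> [Fs|Fs U].
  by apply: (cvg_comp _ _ Fs); exact: (@initial_continuous _ _ f).
rewrite nbhsE => -[B [[C oC <-] Cs] BU].
by apply: filterS BU _; apply: Fs; exact: open_nbhs_nbhs.
Qed.

Lemma wstar_cvgP (F : set_system (circle_prob R)) (mu : circle_prob R) :
  Filter F ->
  F --> mu <->
  forall f : continuousType (circle R) R,
    integral_map nu f @[nu --> F] --> integral_map mu f.
Proof.
move=> FF; apply: (iff_trans (@cvg_initialP _ _ (@integral_map R) F mu FF)).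
rewrite cvg_sup; split=> H f.
  by have /cvg_initialP := H f; exact.
by apply/cvg_initialP; exact: H.
Qed.

(* Two measures that agree on Borel sets may differ as Rocq terms, because the
   type [probability] also records values on non-measurable sets. Such measures
   lie in the same open sets, so they are the same point for every topological
   purpose. *)
Lemma integral_map_measure_eq mu nu :
  (forall A, measurable A -> mu A = nu A) ->
  integral_map mu = integral_map nu.
Proof.
move=> munu; apply/funext => f; rewrite /integral_map /Rintegral.
by congr fine; apply: eq_measure_integral => A mA _; exact: munu.
Qed.

End wstar_theory.

Section invariant_measures.
Context {R : realType}.

Definition invariant_prob (p : nat) : set (circle_prob R) :=
  [set mu | forall A, measurable A -> times_push p%:Z mu A = mu A].

Definition atom_free (mu : circle_prob R) : Prop :=
  forall x : circle R, mu [set x] = 0%E.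

(* A subset of the space [invariant_prob p], which carries the topology induced
   by the w*-topology of [circle_prob R]. *)
Definition non_equidistributed (p : nat) (c : nat -> int) :
    set (invariant_prob p) :=
  [set mu | atom_free (set_val mu) /\
    ~ (times_push (c n) (set_val mu) @[n --> \oo] --> circle_leb)].

End invariant_measures.

Definition residual {X : topologicalType} (A : set X) : Prop :=
  exists B : set X, [/\ Gdelta B, dense B & B `<=` A].

(* Main.v *)
Require Import Defs.
From HB Require Import structures.
From mathcomp Require Import all_boot all_order all_algebra.
From mathcomp Require Import all_classical all_reals all_analysis.
From mathcomp Require Import measurable_realfun cyclic.
From mathcomp Require Import ring lra zify.

Import Order.TTheory GRing.Theory Num.Theory.
Import numFieldNormedType.Exports.

(** The set of measures in question contains an intersection of countably many
    dense open subsets of the space [K] of [p]-invariant probabilities, and [K]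
    is a Baire space.

    Fix one continuous function [f] on the circle (the distance to 0), and
    write [T_m] for multiplication by [m]. Three kinds of open conditions on
    [mu] are imposed.
    - The integral of [f \o T_(c 1)] against [mu] differs from the Lebesgue
      integral of [f]. This is dense because [mu] may be mixed with a small
      multiple of the Dirac mass at 0, which is invariant and where [f]
      vanishes ([integral_neq_dense]).
    - For some [n >= N], the integrals of [f \o T_(c n)] and [f \o T_(c 1)]
      against [mu] are at distance less than [1 / (N + 1)].
    - The circle is covered by finitely many arcs of small mass, which in the
      limit excludes atoms ([small_bumps_atom_free]).
    A measure satisfying all of them has no atom, and its images [T_(c n) mu]
    come back, on [f], near [T_(c 1) mu], hence stay away from the Lebesgue
    measure for infinitely many [n] ([recurrent_not_equidistributed]).

    The heart of the matter is that the last two conditions are dense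
    ([recurrent_small_bumps_dense]). Let [q = 1 + p + ... + p^k]. Round a
    [mu]-random point [x] down to a multiple of [1/q], shift it by a uniformly
    chosen number of steps [1/q] among the first few, and average the laws of
    the images under [T_(p^i)], [i <= k]. As [q] divides [p^(k+1) - 1] the
    result is invariant ([orbit_average_invariant]), and it is close to [mu]
    because [mu] is itself the average of its images and the rounding error,
    about [1/q], is still small after multiplication by [p^i], except for a
    bounded number of indices [i] ([orbit_average_rounding_dist]). The random
    shift makes all atoms small ([integral_bump_le]). Now the coprimality of
    [a L] with [p] provides arbitrarily large [k] for which [q] is prime to
    [a L] ([coprime_repunit]); for these the recurrence can be run backwards
    modulo [q], so [c] is purely periodic modulo [q] from index 1 on, and
    [c n = c 1] modulo [q] for infinitely many [n]
    ([linear_recurrence_returns]). On the multiples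
    of [1/q] the maps [T_(c n)] and [T_(c 1)] then coincide.

    That [K] is a Baire space follows from the weak-star compactness of the
    probabilities on the circle ([circle_prob_compact]): along an ultrafilter
    the distribution functions converge pointwise, and the right-continuous
    regularization of the limit is the distribution function of a limit
    probability. Moreover [K] is closed because a Borel probability is
    determined by the integrals of continuous functions
    ([circle_prob_unique]). *)

Set Implicit Arguments.
Unset Strict Implicit.
Unset Printing Implicit Defensive.

Local Open Scope classical_set_scope.
Local Open Scope ring_scope.

(** * Repunits, and linear recurrences modulo an integer *)

Section arithmetic.

Definition repunit (p k : nat) : nat := (\sum_(i < k) p ^ i)%N.

Lemma repunit_ge p k : (p ^ k <= repunit p k.+1)%N.
Proof. by rewrite /repunit big_ord_recr/= leq_addl. Qed.

Lemma repunit_dvd p k : (repunit p k %| (p ^ k).-1)%N.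
Proof. by rewrite predn_exp dvdn_mull. Qed.

Lemma coprime_repunit_base p k : coprime (repunit p k.+1) p.
Proof.
rewrite coprime_sym /repunit big_ord_recl/= expn0.
have -> : (\sum_(i < k) p ^ fintype.bump 0 i = (\sum_(i < k) p ^ i) * p)%N.
  by rewrite big_distrl/=; apply: eq_bigr => i _; rewrite /fintype.bump/= add1n expnSr.
by rewrite /coprime gcdnC addnC gcdnC gcdnMDl gcdn1.
Qed.

(** Euler's theorem makes [a * p.-1] divide [p ^ t - 1] when [t] is a multiple
    of the totient, so [a] divides the repunit of length [t]; one more digit
    gives a repunit congruent to 1 modulo [a]. *)
Lemma coprime_repunit (a p m : nat) : (0 < a)%N -> (1 < p)%N -> coprime a p ->
  coprime (repunit p (m * totient (a * p.-1)).+1) a.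
Proof.
move=> a0 p1 ap; set t := (m * _)%N.
have h : (a %| repunit p t)%N.
  have p0 : (0 < p.-1)%N by lia.
  rewrite -(dvdn_pmul2r p0) [(repunit _ _ * _)%N]mulnC -predn_exp -[(p ^ t).-1]subn1.
  rewrite -eqn_mod_dvd ?expn_gt0 ?(ltnW p1)// /t mulnC expnM.
  rewrite -modnXm Euler_exp_totient ?modnXm ?exp1n//.
  rewrite coprimeMr coprime_sym ap/= coprime_sym.
  by rewrite -[p in coprime _ p](prednK (ltnW p1)) coprimenS.
rewrite /repunit big_ord_recl/= expn0.
have -> : (\sum_(i < t) p ^ fintype.bump 0 i = p * repunit p t)%N.
  by rewrite big_distrr/=; apply: eq_bigr => i _; rewrite /fintype.bump/= add1n expnS.
have /dvdnP[r ->] := h.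
by rewrite mulnA /coprime gcdnC addnC gcdnMDl gcdn1.
Qed.

Lemma intr_Zp_eq0 (q : nat) (x : int) : (1 < q)%N ->
  x%:~R = 0 :> 'Z_q -> (q%:Z %| x)%Z.
Proof.
move=> q1; rewrite dvdzE/=.
have h (n : nat) : n%:R = 0 :> 'Z_q -> (q %| n)%N.
  by move=> /(congr1 val); rewrite /= val_Zp_nat// => /eqP.
by case: x => n /=; [exact: h|rewrite NegzE mulrNz => /eqP; rewrite oppr_eq0 => /eqP/h].
Qed.

(** The vector of [L] consecutive terms modulo [q] evolves under the companion
    map, which is injective as [a L] is invertible modulo [q]. An injective map
    of a finite set permutes it, so the vector starting at index 1 recurs. *)
Lemma linear_recurrence_returns (q L : nat) (a c : nat -> int) :
  (1 < q)%N -> (1 <= L)%N ->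
  (forall n : nat, (L < n)%N ->
    c n = \sum_(1 <= i < L.+1) a i * c (n - i)%N) ->
  coprimez (a L) q%:Z ->
  forall N, exists2 n, (N <= n)%N & (q%:Z %| c n - c 1%N)%Z.
Proof.
move=> q1; case: L => // L' _ rec cop N.
pose Z := 'Z_q.
pose f (v : {ffun 'I_L'.+1 -> Z}) : {ffun 'I_L'.+1 -> Z} :=
  [ffun i : 'I_L'.+1 => if i == L' :> nat
     then \sum_(j < L'.+1) (a j.+1)%:~R * v (inord (L' - j)) else v (inord i.+1)].
pose s n : {ffun 'I_L'.+1 -> Z} := [ffun i : 'I_L'.+1 => (c (n + i)%N)%:~R].
have fs n : f (s n.+1) = s n.+2.
  apply/ffunP => i; rewrite !ffunE; case: eqP => [->|iL].
    rewrite rec; last by lia.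
    rewrite big_add1/= big_mkord rmorph_sum/=; apply: eq_bigr => j _.
    have jL := ltn_ord j.
    rewrite ffunE inordK; last by lia.
    by rewrite rmorphM/=; congr (_ * (c _)%:~R); lia.
  have iL' := ltn_ord i.
  by rewrite inordK; [congr ((c _)%:~R); lia|lia].
have injf : injective f.
  move=> v w vw.
  have vwS k : (k < L')%N -> v (inord k.+1) = w (inord k.+1).
    move=> kL; have /ffunP/(_ (inord k)) := vw.
    rewrite !ffunE inordK; last by lia.
    by case: eqP => // e; exfalso; lia.
  have vw0 : v (inord 0) = w (inord 0).
    have /ffunP/(_ ord_max) := vw; rewrite !ffunE/= eqxx !big_ord_recr/= subnn.
    rewrite (eq_bigr (fun j : 'I_L' => (a j.+1)%:~R * w (inord (L' - j)))); last first.
      move=> j _; have jL := ltn_ord j.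
      by rewrite -[(L' - j)%N]prednK ?vwS//; lia.
    move/addrI; case/coprimezP: cop => -[u t] /= /(congr1 (fun x : int => x%:~R : Z)).
    rewrite rmorphD !rmorphM/= => e ea.
    rewrite -[LHS]mul1r -[RHS]mul1r -[1]/(1%:~R : Z) -e.
    rewrite (_ : (q%:Z)%:~R = 0 :> Z); last exact: pchar_Zp.
    by rewrite mulr0 addr0 -!mulrA ea.
  apply/ffunP => i; rewrite -(inord_val i); case: (val i) (ltn_ord i) => [|k] kL //.
  exact: vwS.
have sit m : s m.+1 = iter m f (s 1%N).
  by elim: m => [|m IH] //; rewrite iterS -IH fs.
have per m : iter (m * order f (s 1%N)) f (s 1%N) = s 1%N.
  elim: m => [|m IH] //; rewrite mulSn iterD IH; exact: iter_order.
exists (N * order f (s 1%N)).+1.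
  by rewrite (leq_trans _ (leqnSn _))// leq_pmulr// order_gt0.
apply: intr_Zp_eq0 => //.
have /ffunP/(_ ord0) : s (N * order f (s 1%N)).+1 = s 1%N by rewrite sit per.
by rewrite !ffunE/= !addn0 rmorphB/= => ->; rewrite subrr.
Qed.

End arithmetic.

(** * The circle: a section of the projection, and the distance to zero *)

Section circle_basics.
Context {R : realType}.
Implicit Types (x y : R) (z w : circle R).

Lemma circle_continuousP (Y : topologicalType) (f : circle R -> Y) :
  continuous (fun x : R => f (circle_proj x)) -> continuous f.
Proof. by move=> cf; apply/(@quotient_continuous R (circle_group R)). Qed.

Lemma circle_open (U : set (circle R)) :
  open [set x : R | U (circle_proj x)] -> open U.
Proof. by []. Qed.

Lemma circle_proj_int x (m : int) : circle_proj (x + m%:~R) = circle_proj x.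
Proof. by apply/circle_proj_eq; rewrite addrAC subrr add0r intr_int. Qed.

Lemma circle_proj0 : circle_proj (0 : R) = 0.
Proof. by rewrite -(subrr (0:R)) circle_projB subrr. Qed.

Lemma circle_projD x y : circle_proj (x + y) = circle_proj x + circle_proj y.
Proof.
rewrite -{1}[y]opprK circle_projB -[- y]sub0r circle_projB circle_proj0.
by rewrite sub0r opprK.
Qed.

(** The representative of [z] in [[0, 1[]. *)
Definition circle_sec z : measurableTypeR R :=
  repr z - (Num.floor (repr z))%:~R.

Lemma circle_secK : cancel circle_sec circle_proj.
Proof.
move=> z; rewrite /circle_sec -mulrNz circle_proj_int.
by rewrite /circle_proj reprK.
Qed.

Lemma circle_sec_ge0 z : 0 <= circle_sec z.
Proof. by rewrite /circle_sec subr_ge0 floor_le. Qed.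

Lemma circle_sec_lt1 z : circle_sec z < 1.
Proof. by rewrite /circle_sec ltrBlDl -[1]/(1%:~R) -intrD floorD1_gt. Qed.

Lemma circle_sec_proj x :
  exists m : int, circle_sec (circle_proj x) = x + m%:~R.
Proof.
have /circle_proj_eq/intrP[m hm] := circle_secK (circle_proj x).
by exists m; rewrite -hm addrC subrK.
Qed.

(** A ray [`]a, +oo[] with [0 <= a] pulls back to the arc from [a] to 1, which
    is open because the union of the integer translates of [`]a, 1[] is. *)
Lemma circle_sec_measurable : measurable_fun setT circle_sec.
Proof.
apply: (measurability _ (RGenOInfty.measurableE R)) => //.
move=> _ [_ [a ->] <-]; rewrite setTI.
have [a0|a0] := ltP a 0.
  rewrite (_ : _ @^-1` _ = setT)//; apply/seteqP; split=> z //= _.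
  by rewrite in_itv/= andbT (lt_le_trans a0)// circle_sec_ge0.
apply: sub_gen_smallest; apply: circle_open.
rewrite (_ : [set x | _] = \bigcup_(m in [set: int]) `]a + m%:~R, 1 + m%:~R[%classic).
  by apply: bigcup_open => m _; exact: interval_open.
apply/seteqP; split=> x /=.
  have [m hm] := circle_sec_proj x.
  have := circle_sec_lt1 (circle_proj x).
  rewrite !in_itv/= andbT hm => h1 ha; exists (- m) => //=.
  by rewrite in_itv/= rmorphN/= ltrBlDr ltrBrDr ha.
move=> [m _] /=; rewrite !in_itv/= andbT => /andP[am m1].
have [k hk] := circle_sec_proj x.
suff : k = - m by move=> e; rewrite hk e rmorphN/= ltrBrDr.
have := circle_sec_lt1 (circle_proj x); have := circle_sec_ge0 (circle_proj x).
rewrite hk => k0 k1.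
have h1 : (k + m)%:~R < 1%:~R :> R by rewrite rmorphD/=; lra.
have h2 : (-1)%:~R < (k + m)%:~R :> R by rewrite rmorphD/=; lra.
rewrite !ltr_int in h1 h2; lia.
Qed.

HB.instance Definition _ :=
  isMeasurableFun.Build _ _ _ _ circle_sec circle_sec_measurable.

(** The distance from [x] to the nearest integer. *)
Definition dist_int x : R := `|x - (Num.floor (x + 2^-1))%:~R|.

Lemma dist_int_le x (m : int) : dist_int x <= `|x - m%:~R|.
Proof.
rewrite /dist_int; have /andP[] := floor_itv (x + 2^-1).
set n := Num.floor _; rewrite intrD => h1 h2.
have [->//|] := eqVneq m n; rewrite neq_lt => /orP[] mn.
  have : (m + 1)%:~R <= n%:~R :> R by rewrite ler_int; lia.
  by rewrite intrD => h3; rewrite ler_norml; have := ler_norm (x - m%:~R);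
    move: h1 h2 h3; set t : R := _%:~R; set s : R := _%:~R => *; lra.
have : (n + 1)%:~R <= m%:~R :> R by rewrite ler_int; lia.
rewrite intrD => h3; rewrite ler_norml -normrN; have := ler_norm (- (x - m%:~R)).
by move: h1 h2 h3; set t : R := _%:~R; set s : R := _%:~R => *; lra.
Qed.

Lemma dist_intD x (m : int) : dist_int (x + m%:~R) = dist_int x.
Proof.
apply/eqP; rewrite eq_le; apply/andP; split.
  rewrite {2}/dist_int (le_trans (dist_int_le _ (Num.floor (x + 2^-1) + m)))//.
  by rewrite intrD opprD addrACA subrr addr0.
rewrite {2}/dist_int.
rewrite (le_trans (dist_int_le _ (Num.floor (x + m%:~R + 2^-1) - m)))//.
by rewrite intrD rmorphN/= opprD opprK addrA addrAC.
Qed.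

Definition circle_norm z : R := dist_int (circle_sec z).

Lemma circle_norm_proj x : circle_norm (circle_proj x) = dist_int x.
Proof.
by rewrite /circle_norm; have [m ->] := circle_sec_proj x; rewrite dist_intD.
Qed.

Lemma circle_norm_ge0 z : 0 <= circle_norm z.
Proof. exact: normr_ge0. Qed.

Lemma circle_normD z w : circle_norm (z + w) <= circle_norm z + circle_norm w.
Proof.
rewrite -(circle_secK z) -(circle_secK w) -circle_projD !circle_norm_proj.
set x := circle_sec z; set y := circle_sec w; rewrite {2 3}/dist_int.
rewrite (le_trans (dist_int_le _ (Num.floor (x + 2^-1) + Num.floor (y + 2^-1))))//.
by rewrite intrD opprD addrACA ler_normD.
Qed.

Lemma circle_normN z : circle_norm (- z) = circle_norm z.
Proof.
suff h w : circle_norm (- w) <= circle_norm w.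
  by apply/eqP; rewrite eq_le h/= -{1}[z]opprK h.
rewrite -(circle_secK w) -[- _]add0r.
rewrite -circle_proj0 -circle_projB !circle_norm_proj sub0r {2}/dist_int.
rewrite (le_trans (dist_int_le _ (- Num.floor (circle_sec w + 2^-1))))//.
by rewrite mulrNz opprK addrC [leLHS]distrC.
Qed.

Lemma circle_norm_le x : circle_norm (circle_proj x) <= `|x|.
Proof. by rewrite circle_norm_proj (le_trans (dist_int_le _ 0))// subr0. Qed.

Lemma circle_norm0 : circle_norm (0 : circle R) = 0.
Proof.
apply/eqP; rewrite eq_le circle_norm_ge0 andbT -circle_proj0.
by rewrite (le_trans (circle_norm_le _))// normr0.
Qed.

Lemma circle_norm_rep z :
  exists2 u : R, z = circle_proj u & `|u| = circle_norm z.
Proof.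
exists (circle_sec z - (Num.floor (circle_sec z + 2^-1))%:~R) => //.
by rewrite -mulrNz circle_proj_int circle_secK.
Qed.

Lemma circle_norm_eq0 (z : circle R) : circle_norm z = 0 -> z = 0.
Proof.
have [u -> <-] := circle_norm_rep z.
by move/eqP; rewrite normr_eq0 => /eqP ->; rewrite circle_proj0.
Qed.

(** One-sided Lipschitz bounds suffice since the roles of [z] and [w] can be
    exchanged; this is how all explicit test functions are shown continuous. *)
Lemma circle_lip_continuous (f : circle R -> R) (C : R) :
  (forall z w, f z <= f w + C * circle_norm (z - w)) -> continuous f.
Proof.
move=> fC; apply: circle_continuousP => x.
have C0 : 0 <= `|C| + 1 by rewrite addr_ge0.
apply/cvgrPdist_le => e e0; near=> y.
have h z w : f z - f w <= (`|C| + 1) * circle_norm (z - w).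
  rewrite lerBlDl (le_trans (fC z w))// lerD2l ler_wpM2r ?circle_norm_ge0//.
  by apply: (le_trans (ler_norm _)); rewrite lerDl.
apply: (@le_trans _ _ ((`|C| + 1) * `|x - y|)).
  apply: (@le_trans _ _ ((`|C| + 1) * circle_norm (circle_proj x - circle_proj y))).
    by rewrite ler_norml lerNl opprB h -circle_normN opprB h.
  by rewrite ler_wpM2l// -circle_projB circle_norm_le.
rewrite mulrC -ler_pdivlMr ?ltr_wpDl//; near: y.
by apply: cvgr_dist_le; rewrite ?divr_gt0 ?ltr_wpDl//; exact: cvg_id.
Unshelve. all: by end_near. Qed.

(** Together with the continuity of [circle_norm], this says that it induces
    the quotient topology. *)
Lemma circle_open_ball (U : set (circle R)) z : open U -> U z ->
  exists2 r : R, 0 < r & forall w, circle_norm (w - z) < r -> U w.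
Proof.
move=> oU Uz.
have : open [set x : R | U (circle_proj x)] by [].
rewrite openE => /(_ (circle_sec z)); rewrite /= circle_secK => /(_ Uz).
rewrite /interior => /nbhs_ballP[r /= r0 hr]; exists r => // w.
have [u hu <-] := circle_norm_rep (w - z) => ur.
have := hr (circle_sec z + u).
rewrite /= circle_projD circle_secK -hu [z + _]addrC subrK; apply.
by rewrite /ball/= opprD addrA subrr sub0r normrN.
Qed.

End circle_basics.

(** * Bounded measurable functions and mixtures of probabilities *)

Section bounded_measurable.
Context d (T : measurableType d) (R : realType).
Implicit Types (P : probability T R) (f g : T -> R).

(** Integrals of such functions against a probability are linear and monotone
    with no further integrability condition. *)
Definition bounded_measurable f :=
  measurable_fun setT f /\ exists M, forall x, `|f x| <= M.

Lemma bounded_measurable_integrable P f :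
  bounded_measurable f -> P.-integrable setT (EFin \o f).
Proof.
move=> [mf [M hM]]; apply: measurable_bounded_integrable => //.
  by rewrite -ge0_fin_numE// fin_num_measure.
exists M; split; first exact: num_real.
by move=> y My x _; apply: (le_trans (hM x)); exact: ltW.
Qed.

Lemma bounded_measurableD f g : bounded_measurable f -> bounded_measurable g ->
  bounded_measurable (fun x => f x + g x).
Proof.
move=> [mf [M hM]] [mg [N hN]]; split; first exact: measurable_funD.
by exists (M + N) => x; rewrite (le_trans (ler_normD _ _))// lerD.
Qed.

Lemma bounded_measurableZ (r : R) f : bounded_measurable f ->
  bounded_measurable (fun x => r * f x).
Proof.
move=> [mf [M hM]]; split; first exact: measurable_funM.
by exists (`|r| * M) => x; rewrite normrM ler_wpM2l.
Qed.

Lemma bounded_measurableB f g : bounded_measurable f -> bounded_measurable g ->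
  bounded_measurable (fun x => f x - g x).
Proof.
move=> bf /(bounded_measurableZ (-1)) /(bounded_measurableD bf).
by congr (bounded_measurable _); apply/funext => x; rewrite mulN1r.
Qed.

Lemma bounded_measurable_cst (r : R) : bounded_measurable (fun=> r).
Proof. by split; [exact: measurable_cst|exists `|r|]. Qed.

Lemma Rintegral_prob_cst P (r : R) : \int[P]_x r = r.
Proof. by rewrite Rintegral_cst//= probability_setT mulr1. Qed.

Lemma Rintegral_bm_le P f g : bounded_measurable f -> bounded_measurable g ->
  (forall x, f x <= g x) -> \int[P]_x f x <= \int[P]_x g x.
Proof.
by move=> bf bg fg; apply: le_Rintegral => //; exact: bounded_measurable_integrable.
Qed.

Lemma Rintegral_bmD P f g : bounded_measurable f -> bounded_measurable g ->
  \int[P]_x (f x + g x) = \int[P]_x f x + \int[P]_x g x.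
Proof. by move=> *; rewrite RintegralD//; exact: bounded_measurable_integrable. Qed.

Lemma Rintegral_bm_sum P (n : nat) (F : nat -> T -> R) :
  (forall i, bounded_measurable (F i)) ->
  bounded_measurable (fun x => \sum_(i < n) F i x) /\
  \int[P]_x (\sum_(i < n) F i x) = \sum_(i < n) \int[P]_x F i x.
Proof.
move=> bF; elim: n => [|n [bS IH]].
  have e : (fun x => \sum_(i < 0) F i x) = fun=> 0.
    by apply/funext => x; rewrite big_ord0.
  rewrite e [X in _ /\ _ = X]big_ord0; split; first exact: bounded_measurable_cst.
  by rewrite -[RHS](Rintegral_prob_cst P) -e.
have e : (fun x => \sum_(i < n.+1) F i x) = fun x => \sum_(i < n) F i x + F n x.
  by apply/funext => x; rewrite big_ord_recr.
rewrite e [X in _ /\ _ = X]big_ord_recr/= -IH -Rintegral_bmD//; split=> //.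
  exact: bounded_measurableD.
Qed.

Lemma Rintegral_bm_dist P f g (e : R) :
  bounded_measurable f -> bounded_measurable g ->
  (forall x, `|f x - g x| <= e) -> `|\int[P]_x f x - \int[P]_x g x| <= e.
Proof.
move=> bf bg fg; have be := bounded_measurable_cst e.
rewrite ler_distl; apply/andP; split.
  rewrite lerBlDr -[leRHS](_ : \int[P]_x (f x + e) = _); last first.
    by rewrite Rintegral_bmD// Rintegral_prob_cst.
  apply: Rintegral_bm_le => //; first exact: bounded_measurableD.
  by move=> x; have := fg x; rewrite ler_distl => /andP[]; lra.
rewrite -[leRHS](_ : \int[P]_x (g x + e) = _); last first.
  by rewrite Rintegral_bmD// Rintegral_prob_cst.
apply: Rintegral_bm_le => //; first exact: bounded_measurableD.
by move=> x; have := fg x; rewrite ler_distl => /andP[]; lra.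
Qed.

Definition mixture (t : {i01 R}) P (Q : probability T R) : set T -> \bar R :=
  measure_add (mscale ((1 - t%:num)%:nng) P) (mscale (t%:num%:nng) Q).

Section mixture_probability.
Variables (t : {i01 R}) (P Q : probability T R).

HB.instance Definition _ := Measure.on (mixture t P Q).

Let mixtureT : mixture t P Q setT = 1%E.
Proof.
rewrite /mixture measure_addE/= /mscale/= !probability_setT !mule1 -EFinD.
by rewrite subrK.
Qed.

HB.instance Definition _ := Measure_isProbability.Build _ _ _
  (mixture t P Q) mixtureT.

Lemma Rintegral_mixture f : bounded_measurable f ->
  \int[mixture t P Q]_x f x = (1 - t%:num) * \int[P]_x f x + t%:num * \int[Q]_x f x.
Proof.
(* adding a bound of [f] reduces to nonnegative functions *)
wlog f0 : f / forall x, 0 <= f x => [hw|] bf.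
  have [_ [M hM]] := bf.
  pose g x := f x + M.
  have bg : bounded_measurable g.
    by apply: bounded_measurableD => //; exact: bounded_measurable_cst.
  have h (P' : probability T R) : \int[P']_x f x = \int[P']_x g x - M.
    by rewrite Rintegral_bmD ?Rintegral_prob_cst ?addrK//; exact: bounded_measurable_cst.
  rewrite !h hw//; first by ring.
  by move=> x; rewrite /g; have := hM x; rewrite ler_norml => /andP[]; lra.
have mf : measurable_fun setT (EFin \o f) by apply/measurable_EFinP; case: bf.
have fin (P' : probability T R) : (\int[P']_x (f x)%:E \is a fin_num)%E.
  by apply: integrable_fin_num => //; exact: bounded_measurable_integrable.
rewrite /Rintegral [X in fine X](_ : _ = ((1 - t%:num)%:E * \int[P]_x (f x)%:E
    + t%:num%:E * \int[Q]_x (f x)%:E)%E).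
  by rewrite fineD ?fin_numM// !fineM.
rewrite ge0_integral_measure_add//; last by move=> x _; rewrite lee_fin.
by rewrite !ge0_integral_mscale//; move=> x _; rewrite lee_fin.
Qed.

End mixture_probability.

Lemma avg_weight (n : nat) : 0 <= (n.+1%:R^-1 : R) <= 1.
Proof. by rewrite invr_ge0 ler0n invf_le1// ?ler1n ?ltr0n. Qed.

(** The arithmetic mean of [P 0], ..., [P n]: the step mixes [P n] with weight
    [1 / (n + 1)] into the mean of its predecessors. *)
Fixpoint average (n : nat) (P : nat -> probability T R) : probability T R :=
  if n is n'.+1 then
    mixture (Itv01 (proj1 (andP (avg_weight n))) (proj2 (andP (avg_weight n))))
      (average n' P) (P n)
  else P 0%N.

Lemma Rintegral_average n (P : nat -> probability T R) f :
  bounded_measurable f ->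
  \int[average n P]_x f x = n.+1%:R^-1 * \sum_(i < n.+1) \int[P i]_x f x.
Proof.
move=> bf; elim: n => [|n IH]; first by rewrite big_ord1 invr1 mul1r.
rewrite [average _ _]/(mixture _ _ _ : probability T R) Rintegral_mixture// IH/=.
rewrite [in RHS]big_ord_recr/= mulrDr; congr (_ + _); rewrite mulrA; congr (_ * _).
rewrite -[n.+2%:R]natr1; have : 0 < n.+1%:R :> R by rewrite ltr0n.
by move: (n.+1%:R : R) => x x0; field; rewrite !gt_eqF ?addr_gt0.
Qed.

End bounded_measurable.

(** * Continuous functions on the circle determine Borel probabilities *)

Lemma Rintegral_distribution d d' (T : measurableType d) (T' : measurableType d')
    (R : realType) (P : probability T R) (X : {mfun T >-> T'}) (f : T' -> R) :
  bounded_measurable f ->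
  \int[distribution P X]_y f y = \int[P]_x f (X x).
Proof.
move=> [mf [M hM]]; congr fine; rewrite integral_pushforward//.
  exact/measurable_EFinP.
rewrite preimage_setT.
rewrite [X in _.-integrable _ X](_ : _ = EFin \o (f \o X))//.
apply: bounded_measurable_integrable; split; first exact: measurableT_comp.
by exists M => x; exact: hM.
Qed.

Section circle_integrals.
Context {R : realType}.
Implicit Types (f : circle R -> R) (mu nu : circle_prob R).

(** Uniform continuity is stated on lifts to the line, where the maps [T_m] act
    by multiplication. Compactness of [[0, 1]] gives it near that interval, and
    periodicity everywhere. *)
Lemma circle_uniform_continuous f : continuous f -> forall e : R, 0 < e ->
  exists2 r : R, 0 < r & forall x y : R, `|x - y| < r ->
    `|f (circle_proj x) - f (circle_proj y)| < e.
Proof.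
move=> cf e e0; pose g (x : R) := f (circle_proj x).
have cg : continuous g.
  by move=> x; apply: continuous_comp; [exact: circle_proj_continuous|exact: cf].
have /compact_near_coveringP nc := @segment_compact R 0 1.
have := nc R (0^'+) (fun r x => forall y, `|x - y| < r -> `|g x - g y| < e).
case.
  move=> x _; have e20 : 0 < e / 2 by rewrite divr_gt0.
  have /cvgrPdist_lt/(_ _ e20) /nbhs_ballP[r /= r0 hr] := cg x.
  near=> x' r'.
  have r'2 : r' < r / 2 by near: r'; apply: nbhs_right_lt; rewrite divr_gt0.
  have xx' : `|x - x'| < r / 2.
    by near: x'; apply: nbhsx_ballx; rewrite divr_gt0.
  move=> y x'y.
  have h1 : `|g x - g x'| < e / 2.
    by apply: hr; rewrite /ball/= (lt_trans xx')// ltr_pdivrMr// ltr_pMr// ltr1n.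
  have h2 : `|g x - g y| < e / 2.
    apply: hr; rewrite /ball/= -(subrKA x') (le_lt_trans (ler_normD _ _))//.
    by rewrite [r]splitr ltrD// (lt_trans x'y).
  rewrite -(subrKA (g x)) (le_lt_trans (ler_normD _ _))// [e]splitr ltrD//.
  by rewrite distrC.
move=> r /= r0 hr; have r20 : 0 < r / 2 by rewrite divr_gt0.
exists (r / 2) => // x y xy.
have e1 (t : R) m : f (circle_proj t) = g (t + m%:~R).
  by rewrite /g circle_proj_int.
rewrite (e1 x (- Num.floor x)) (e1 y (- Num.floor x)).
apply: (hr (r / 2)) => //=; last by rewrite opprD addrACA subrr addr0.
  by rewrite sub0r normrN gtr0_norm// ltr_pdivrMr// ltr_pMr// ltr1n.
rewrite in_itv/= mulrNz subr_ge0 floor_le/= lerBlDl ltW//.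
by rewrite -[1]/(1%:~R) -intrD floorD1_gt.
Unshelve. all: by end_near. Qed.

Lemma circle_bounded_measurable f : continuous f -> bounded_measurable f.
Proof.
move=> cf; split.
  apply: (measurability _ (measurable_realfun.RGenOpens.measurableE R)) => //.
  move=> _ [_ [a [b ->]] <-]; rewrite setTI; apply: sub_gen_smallest.
  by move/continuousP: cf; apply; exact: interval_open.
have [r r0 hr] := circle_uniform_continuous cf ltr01.
have [n nr] : exists n : nat, r^-1 < n%:R.
  by exists (Num.truncn r^-1).+1; rewrite truncnS_gt.
have n0 : 0 < n%:R :> R by rewrite (lt_trans _ nr)// invr_gt0.
(* walk from 0 to [x] in at most [n] steps of length [1/n] *)
have h m (x : R) : 0 <= x -> x <= m%:R / n%:R ->
    `|f (circle_proj x) - f (circle_proj 0)| <= m%:R.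
  elim: m x => [|m IH] x x0.
    rewrite mul0r => x0'; have -> : x = 0 by apply/eqP; rewrite eq_le x0 x0'.
    by rewrite subrr normr0.
  move=> xm; rewrite -natr1.
  have [xn|xn] := leP n%:R^-1 x; last first.
    rewrite -[leLHS]add0r lerD// ltW// hr// subr0 ger0_norm//.
    by rewrite (lt_trans xn)// invf_plt ?posrE.
  rewrite -(subrKA (f (circle_proj (x - n%:R^-1)))) addrC.
  rewrite (le_trans (ler_normD _ _))// lerD//.
    by apply: IH; rewrite ?subr_ge0// lerBlDr -[X in _ + X]mul1r -mulrDl natr1.
  rewrite ltW// hr// opprB addrC subrK gtr0_norm ?invr_gt0//.
  by rewrite invf_plt ?posrE.
exists (`|f (circle_proj 0)| + n%:R) => z; rewrite -(circle_secK z).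
rewrite -[f _](subrK (f (circle_proj 0))) (le_trans (ler_normD _ _))//.
rewrite addrC lerD// h ?circle_sec_ge0// divff ?gt_eqF//.
by rewrite ltW// circle_sec_lt1.
Qed.

(** The indicator of an open set [U] is the increasing limit of the continuous
    functions [min 1 (n * d)], where [d] is the distance to the complement of
    [U], and open sets form a generating pi-system. *)
Lemma circle_prob_unique mu nu :
  (forall f, continuous f -> \int[mu]_x f x = \int[nu]_x f x) ->
  forall A, measurable A -> mu A = nu A.
Proof.
wlog suff : mu nu / (forall f, continuous f -> \int[mu]_x f x = \int[nu]_x f x) ->
    forall U : set (circle R), open U -> (mu U <= nu U)%E.
  move=> hw e A mA.
  apply: (measure_unique (@open (circle R)) (fun=> setT)) => //.
  - by move=> U V; exact: openI.
  - by move=> _; exact: openT.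
  - by rewrite bigcup_const.
  - move=> U oU; apply/eqP; rewrite eq_le hw//= hw// => f cf.
    by rewrite e.
  - by move=> _; rewrite -ge0_fin_numE// fin_num_measure.
move=> e U oU.
have [->|UT] := eqVneq U setT; first by rewrite !probability_setT.
have [y0 Uy0] : ~` U !=set0.
  by apply/set0P; apply: contra_neq UT => /(congr1 setC); rewrite setCK setC0.
pose D z := [set circle_norm (z - y) | y in ~` U].
have D0 z : D z !=set0 by exists (circle_norm (z - y0)); exists y0.
have lD z : has_lbound (D z).
  by exists 0 => _ [y _ <-]; exact: circle_norm_ge0.
pose dU z := inf (D z).
have dU0 z : 0 <= dU z.
  by apply: lb_le_inf => // _ [y _ <-]; exact: circle_norm_ge0.
have dUN z : ~ U z -> dU z = 0.
  move=> Uz; apply/eqP; rewrite eq_le dU0 andbT; apply: ge_inf => //.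
  by exists z => //; rewrite subrr circle_norm0.
have dUP z : U z -> 0 < dU z.
  move=> /(circle_open_ball oU)[r r0 hr]; apply: (lt_le_trans r0).
  apply: lb_le_inf => // _ [y Uy <-]; rewrite leNgt; apply/negP => yr.
  by apply: Uy; apply: hr; rewrite -opprB circle_normN.
have dUL z w : dU z <= dU w + circle_norm (z - w).
  rewrite -lerBlDr; apply: lb_le_inf => // _ [y Uy <-].
  rewrite lerBlDr (@le_trans _ _ (circle_norm (z - y)))//.
    by apply: ge_inf => //; exists y.
  by rewrite -[z - y](subrKA w) [leRHS]addrC circle_normD.
pose f (n : nat) z := Num.min 1 (n%:R * dU z).
have cf n : continuous (f n).
  apply: (@circle_lip_continuous _ _ n%:R) => z w.
  have nn : 0 <= n%:R * circle_norm (z - w) by rewrite mulr_ge0// circle_norm_ge0.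
  rewrite /f /Num.min; have := ler_wpM2l (ler0n R n) (dUL z w); rewrite mulrDr.
  case: ifPn; rewrite -?leNgt => h1; case: ifPn; rewrite -?leNgt => h2 h3;
  by move: nn h1 h2 h3; set a := _ * _; set b := _ * _; set c := _ * _; lra.
pose V (n : nat) := [set z | 1 <= n%:R * dU z].
have mV n : measurable (V n).
  rewrite -[V n]setTI.
  have -> : V n = f n @^-1` [set 1].
    apply/seteqP; split => z; rewrite /V /f/= => h; first by apply/min_idPl.
    by rewrite -{1}h ge_min lexx orbT.
  by have [mf _] := circle_bounded_measurable (cf n); exact: mf.
have mU : measurable U by exact: sub_gen_smallest.
have h n : (mu (V n) <= nu U)%E.
  have fin (m : circle_prob R) A : measurable A -> m A = (\int[m]_x (\1_A x : R))%:E.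
    move=> mA; rewrite /Rintegral integral_indic// setIT fineK//.
    by rewrite fin_num_measure.
  have bI A : measurable A -> bounded_measurable (\1_A : circle R -> R).
    move=> mA; split; first exact: measurable_indic.
    exists 1 => x; rewrite indicE ger0_norm//.
    by case: (_ \in _); rewrite ?ler01.
  rewrite !fin// lee_fin (@le_trans _ _ (\int[mu]_x f n x))//.
    apply: Rintegral_bm_le; [exact: bI|exact: circle_bounded_measurable|].
    move=> z; rewrite indicE; have [|] := boolP (z \in V n).
      by rewrite inE /V/= /f /Num.min => z1; case: ifPn.
    by move=> _; rewrite /f le_min ler01 mulr_ge0.
  rewrite e//; apply: Rintegral_bm_le; [exact: circle_bounded_measurable|exact: bI|].
  move=> z; rewrite indicE; have [|] := boolP (z \in U).
    by rewrite /f ge_min lexx.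
  by rewrite notin_setE => /dUN; rewrite /f => ->; rewrite mulr0 ge_min lexx orbT.
have UV : U = \bigcup_n V n.
  apply/seteqP; split => z.
    move=> /dUP d0; exists (Num.truncn (dU z)^-1).+1 => //=.
    by rewrite /V/= -ler_pdivrMr// div1r ltW// truncnS_gt.
  case=> n _ /= h1; apply: contrapT => /dUN d0.
  by move: h1; rewrite /V/= d0 mulr0 ler10.
have ndV : nondecreasing_seq V.
  move=> n m nm; apply/subsetPset => z; rewrite /V/= => /le_trans; apply.
  by rewrite ler_wpM2r// ler_nat.
rewrite {1}UV.
have cvg := nondecreasing_cvg_mu (mu := mu) mV (bigcup_measurable (fun n _ => mV n)) ndV.
rewrite -(cvg_lim _ cvg)//; apply: lime_le; first by apply: cvgP cvg.
by apply: nearW => n; exact: h.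
Qed.

End circle_integrals.

(** * Riemann-Stieltjes sums *)

Lemma ultra_bounded_cvg (R : realType) T (U : set_system T) (u : T -> R) (a b : R) :
  UltraFilter U -> (forall t, a <= u t <= b) -> exists l : R, u @ U --> l.
Proof.
move=> UU u01; have := @segment_compact R a b (u @ U) _.
case.
  by apply: (@filterS T U _ setT) => [t _|]; [rewrite /= in_itv; exact: u01|exact: filterT].
move=> l [_ lU]; exists l => N lN.
have [//|UN] := in_ultra_setVsetC (u @^-1` N) UU.
have [y [NN Ny]] := lU (~` N) N UN lN.
by exfalso; exact: NN.
Qed.

Section riemann_sums.
Context (R : realType).
Implicit Types (g x G F : R) (e : R).

(** The grid starts at -1, so that mass sitting at 0 is caught by a half-open
    cell [`]a, b]]. *)
Definition grid (n i : nat) : R := -1 + i%:R / n.+1%:R.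

Lemma grid_step n i : grid n i.+1 = grid n i + n.+1%:R^-1.
Proof. by rewrite /grid -natr1 mulrDl mul1r addrA. Qed.

Lemma grid0 n : grid n 0 = -1.
Proof. by rewrite /grid mul0r addr0. Qed.

Lemma grid_last n : grid n (n.+1 * 2) = 1.
Proof.
have h : n.+1%:R != 0 :> R by rewrite pnatr_eq0.
by rewrite /grid natrM mulrAC divff// mul1r; lra.
Qed.

Definition stieltjes_sum (g H : R -> R) (n : nat) : R :=
  \sum_(i < n.+1 * 2) g (grid n i) * (H (grid n i.+1) - H (grid n i)).

(** The differences of indicators select the cell containing [x]; cells up to
    [N] contribute 0 once [x] lies beyond them, which drives the induction. *)
Lemma step_function_dist (g : R -> R) e n : 0 <= e ->
  (forall x y, `|x - y| <= n.+1%:R^-1 -> `|g x - g y| <= e) ->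
  forall x, -1 < x -> x <= 1 ->
  `|g x - \sum_(i < n.+1 * 2) g (grid n i) *
      ((x <= grid n i.+1)%R%:R - (x <= grid n i)%R%:R)| <= e.
Proof.
move=> e0 ge x x0 x1.
pose S N := \sum_(i < N) g (grid n i) *
      ((x <= grid n i.+1)%R%:R - (x <= grid n i)%R%:R).
suff h N : (grid n N < x -> S N = 0) /\ (x <= grid n N -> `|g x - S N| <= e).
  by apply: (h _).2; rewrite grid_last.
elim: N => [|N [IH0 IH1]].
  by split; [rewrite /S big_ord0|rewrite grid0 leNgt x0].
have n0 : 0 < n.+1%:R^-1 :> R by rewrite invr_gt0.
have gN : grid n N < grid n N.+1 by rewrite grid_step ltrDl.
have SN : S N.+1 = S N + g (grid n N) *
      ((x <= grid n N.+1)%R%:R - (x <= grid n N)%R%:R).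
  by rewrite /S big_ord_recr.
rewrite SN; split=> [xN|xN].
  by rewrite IH0 ?(lt_trans gN)// !leNgt xN (lt_trans gN)//= subrr mulr0 addr0.
have [xN'|xN'] := leP x (grid n N).
  by rewrite xN subrr mulr0 addr0 IH1.
rewrite IH0// xN subr0 mulr1 add0r; apply: ge.
by rewrite gtr0_norm ?subr_gt0// lerBlDl -grid_step.
Qed.

Lemma stieltjes_sum_dist d (T : measurableType d) (P : probability T R)
    (X : {mfun T >-> measurableTypeR R}) (g H : R -> R) e n : 0 <= e ->
  bounded_measurable (g : measurableTypeR R -> R) ->
  (forall x y, `|x - y| <= n.+1%:R^-1 -> `|g x - g y| <= e) ->
  (forall t, -1 < (X t : R) <= 1) ->
  (forall x, -1 <= x <= 1 -> P [set t | (X t : R) <= x] = (H x)%:E) ->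
  `|\int[P]_t g (X t) - stieltjes_sum g H n| <= e.
Proof.
move=> e0 bg ge X1 PX.
have n0 : n.+1%:R != 0 :> R by rewrite pnatr_eq0.
have mX x : measurable [set t | (X t : R) <= x].
  have := @measurable_funPTI _ _ _ _ X `]-oo, x]%classic.
  rewrite (_ : _ @^-1` _ = [set t | (X t : R) <= x]); first exact.
  by apply/seteqP; split=> t /=; rewrite in_itv.
have bI x : bounded_measurable (fun t => (((X t : R) <= x)%R%:R : R)).
  split; last by exists 1 => t; rewrite ger0_norm ?ler0n// -[leRHS]/(1%:R) ler_nat leq_b1.
  rewrite (_ : (fun _ => _) = \1_[set t | (X t : R) <= x]); first exact: measurable_indic.
  apply/funext => t; rewrite indicE; congr (_%:R); congr nat_of_bool.
  by apply/idP/idP; rewrite inE.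
have IX x : -1 <= x <= 1 -> \int[P]_t (((X t : R) <= x)%R%:R : R) = H x.
  move=> hx; rewrite -[RHS]/(fine (H x)%:E) -PX//.
  rewrite -(setIT [set t | (X t : R) <= x]) -integral_indic//; congr fine.
  apply: eq_integral => t _; rewrite indicE; congr (_%:R%:E); congr nat_of_bool.
  by apply/idP/idP; rewrite inE.
pose F i t := g (grid n i) * (((X t : R) <= grid n i.+1)%R%:R - ((X t : R) <= grid n i)%R%:R).
have bF i : bounded_measurable (F i).
  by apply: bounded_measurableZ; exact: bounded_measurableB.
have gi i : (i <= n.+1 * 2)%N -> -1 <= grid n i <= 1.
  move=> iN; rewrite -{2}(grid_last n) /grid; apply/andP; split.
    by rewrite lerDl divr_ge0.
  by rewrite lerD2l ler_pM2r ?invr_gt0 ?ltr0n// ler_nat.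
rewrite (_ : stieltjes_sum g H n = \int[P]_t \sum_(i < n.+1 * 2) F i t).
  apply: Rintegral_bm_dist.
  - have [mg [M hM]] := bg; split; last by exists M => t.
    exact: measurableT_comp.
  - by have [] := Rintegral_bm_sum P (n.+1 * 2) bF.
  - by move=> t; have /andP[X0 X1'] := X1 t; exact: step_function_dist.
have [_ ->] := Rintegral_bm_sum P (n.+1 * 2) bF.
apply: eq_bigr => i _; rewrite /F RintegralZl//; last first.
  by apply: bounded_measurable_integrable; exact: bounded_measurableB.
rewrite RintegralB//; [|exact: bounded_measurable_integrable..].
by rewrite !IX// gi//; case: i => i /= /ltnW.
Qed.

(** Both [G] and its right-continuous regularization [F] give nearly the same
    sums: after summation by parts the difference is weighted by the increments
    of [g], at most [e], and by [F - G], which at a grid point is at most the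
    increment of [G] over the next cell, hence sums to at most 1. The grid may
    therefore meet the jumps of [F]. *)
Lemma stieltjes_sum_limit (g G F : R -> R) e n : 0 <= e ->
  (forall x y, `|x - y| <= n.+1%:R^-1 -> `|g x - g y| <= e) ->
  (forall x, G x <= F x) -> (forall x y, x < y -> F x <= G y) ->
  (forall x, 0 <= G x <= 1) ->
  G (-1) = 0 -> F (-1) = 0 -> G 1 = 1 -> F 1 = 1 ->
  `|stieltjes_sum g F n - stieltjes_sum g G n| <= e.
Proof.
move=> e0 ge GF FG G01 Gm Fm G1 F1.
pose D i := F (grid n i) - G (grid n i).
rewrite /stieltjes_sum -sumrB.
have n0 : 0 < n.+1%:R^-1 :> R by rewrite invr_gt0.
have h N : `|\sum_(i < N) (g (grid n i) * (F (grid n i.+1) - F (grid n i)) -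
     g (grid n i) * (G (grid n i.+1) - G (grid n i)))
    - (g (grid n N) * D N - g (grid n 0) * D 0)| <=
    e * (G (grid n N.+1) - G (grid n 1)).
  elim: N => [|N IH]; first by rewrite big_ord0 !subrr normr0 mulr0.
  rewrite big_ord_recr/=; set S := \sum_(i < N) _ in IH *.
  have gg : `|g (grid n N.+1) - g (grid n N)| <= e.
    by apply: ge; rewrite grid_step addrC addKr gtr0_norm.
  have D0 : 0 <= D N.+1 <= G (grid n N.+2) - G (grid n N.+1).
    by rewrite /D subr_ge0 GF lerD2r FG// (grid_step _ N.+1) ltrDl.
  rewrite [X in `|X| <= _](_ : _ = (S - (g (grid n N) * D N - g (grid n 0) * D 0))
     - (g (grid n N.+1) - g (grid n N)) * D N.+1); last by rewrite /D; ring.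
  rewrite (le_trans (ler_normB _ _))//.
  rewrite [leRHS](_ : _ = e * (G (grid n N.+1) - G (grid n 1)) +
    e * (G (grid n N.+2) - G (grid n N.+1))); last by ring.
  rewrite lerD// normrM; have /andP[D1 D2] := D0.
  by rewrite (ger0_norm D1) ler_pM.
have := h (n.+1 * 2)%N; rewrite /D grid_last grid0 Gm Fm G1 F1 !subrr !mulr0 !subr0.
move=> /le_trans; apply; rewrite -[leRHS]mulr1 ler_wpM2l//.
have /andP[_ a1] := G01 (grid n (n.+1 * 2).+1); have /andP[b1 _] := G01 (grid n 1).
by rewrite lerBlDr (le_trans a1)// lerDl.
Qed.

End riemann_sums.

(** * Weak-star compactness of the space of probabilities *)

Section right_limit.
Context (R : realType) (G : R -> R).
Hypotheses (ndG : {homo G : x y / x <= y}).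
Hypotheses (G0 : forall x, x < 0 -> G x = 0) (G1 : forall x, 1 <= x -> G x = 1).

Let G01 x : 0 <= G x <= 1.
Proof.
apply/andP; split.
  have [/G0->//|x0] := ltP x 0.
  by rewrite -(G0 (ltrN10 R)) ndG// (le_trans _ x0)// lerN10.
have [/G1->//|x1] := leP 1 x.
by rewrite -(G1 (lexx 1)) ndG// ltW.
Qed.

Definition right_limit (x : R) := inf [set G y | y in `]x, +oo[].

Let lb x : has_lbound [set G y | y in `]x, +oo[].
Proof. by exists 0 => _ [y _ <-]; have /andP[] := G01 y. Qed.

Let ne x : [set G y | y in `]x, +oo[] !=set0.
Proof. by exists (G (x + 1)); exists (x + 1) => //=; rewrite in_itv/= ltrDl ltr01. Qed.

Lemma right_limit_ge x : G x <= right_limit x.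
Proof.
apply: lb_le_inf => // _ [y /= + <-]; rewrite in_itv/= andbT => xy.
by rewrite ndG// ltW.
Qed.

Lemma right_limit_le x y : x < y -> right_limit x <= G y.
Proof. by move=> xy; apply: ge_inf => //; exists y => //=; rewrite in_itv/= xy. Qed.

Lemma right_limit0 x : x < 0 -> right_limit x = 0.
Proof.
move=> x0; apply/eqP; rewrite eq_le; apply/andP; split.
  rewrite -(G0 (_ : x / 2 < 0)) ?right_limit_le//; lra.
by rewrite (le_trans _ (right_limit_ge x))// G0.
Qed.

Lemma right_limit1 x : 1 <= x -> right_limit x = 1.
Proof.
move=> x1; apply/eqP; rewrite eq_le; apply/andP; split.
  by rewrite -(G1 (_ : 1 <= x + 1)) ?right_limit_le//; lra.
by rewrite (le_trans _ (right_limit_ge x))// G1.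
Qed.

Lemma right_limit_nondecreasing : {homo right_limit : x y / x <= y}.
Proof.
move=> x y; rewrite le_eqVlt => /predU1P[->//|xy].
by rewrite (le_trans (right_limit_le xy))// right_limit_ge.
Qed.

Lemma right_limit_right_continuous : right_continuous right_limit.
Proof.
move=> x; apply/cvgrPdist_le => e e0.
have [_ [y + <-] ye] : exists2 t, [set G y | y in `]x, +oo[] t & t < right_limit x + e.
  by apply: inf_adherent.
rewrite /= in_itv/= andbT => xy; near=> z.
have xz : x < z by [].
have zy : z < y by near: z; exact: nbhs_right_lt.
have h : right_limit x <= right_limit z by apply/right_limit_nondecreasing/ltW.
rewrite distrC ger0_norm ?subr_ge0//.
by rewrite lerBlDl (le_trans (right_limit_le zy))// ltW.
Unshelve. all: by end_near. Qed.

HB.instance Definition _ := isCumulative.Build R _ R right_limit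
  right_limit_nondecreasing right_limit_right_continuous.

Let right_limitNy : right_limit x @[x --> -oo] --> (0 : R).
Proof.
apply: cvg_near_cst; near=> x; apply: right_limit0.
by near: x; exact: nbhs_ninfty_lt.
Unshelve. all: by end_near. Qed.

Let right_limity : right_limit x @[x --> +oo] --> (1 : R).
Proof.
apply: cvg_near_cst; near=> x; apply: right_limit1.
by near: x; exact: nbhs_pinfty_ge.
Unshelve. all: by end_near. Qed.

HB.instance Definition _ := isCumulativeBounded.Build R 0 1 right_limit
  right_limitNy right_limity.

Lemma right_limit_probability :
  exists P : probability (measurableTypeR R) R,
    forall x, P [set y | y <= x] = (right_limit x)%:E.
Proof.
exists (lebesgue_stieltjes_measure right_limit) => x.
rewrite -cdf_lebesgue_stieltjes_id /cdf/= /distribution /pushforward/=.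
by congr (lebesgue_stieltjes_measure _ _); apply/seteqP; split => y /=; rewrite in_itv.
Qed.

End right_limit.

Section clamp.
Context (R : realType).

(** Composing with this retraction onto [[0, 1]] makes the bounds on the
    limiting random variable hold everywhere rather than almost everywhere. *)
Definition clamp (x : measurableTypeR R) : measurableTypeR R := Num.max 0 (Num.min 1 (x : R)).

Lemma clamp_measurable : measurable_fun setT clamp.
Proof.
apply: measurable_maxr; first exact: measurable_cst.
by apply: measurable_minr; [exact: measurable_cst|exact: measurable_id].
Qed.

HB.instance Definition _ :=
  isMeasurableFun.Build _ _ _ _ clamp clamp_measurable.

End clamp.

Section compactness.
Context {R : realType}.

Lemma measurable_sec_le (x : R) : measurable [set z : circle R | circle_sec z <= x].
Proof.
have := @measurable_funPTI _ _ _ _ (@circle_sec R) `]-oo, x]%classic.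
rewrite (_ : _ @^-1` _ = [set t | circle_sec t <= x]); first exact.
by apply/seteqP; split=> t /=; rewrite in_itv.
Qed.

(** Helly's selection argument along an ultrafilter: the distribution functions
    of the lifts to [[0, 1[] converge pointwise to some [G], and the probability
    with distribution function [right_limit G], projected to the circle, is a
    limit. Mass escaping to 1 is not lost, since 0 and 1 are the same point of
    the circle. *)
Lemma circle_prob_compact : compact [set: circle_prob R].
Proof.
rewrite compact_ultra => U UU _.
pose H (mu : circle_prob R) (x : R) : R := fine (mu [set z | circle_sec z <= x]).
have H01 x mu : 0 <= H mu x <= 1.
  rewrite /H fine_ge0//= -[leRHS]/(fine 1%E) fine_le//.
    by rewrite fin_num_measure//; exact: measurable_sec_le.
  by apply: probability_le1; exact: measurable_sec_le.
have [G GU] : {G : R -> R & forall x, H mu x @[mu --> U] --> G x}.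
  apply: (@choice _ _ (fun x g => H mu x @[mu --> U] --> g)) => x.
  by apply: ultra_bounded_cvg; exact: H01.
have G01 x : 0 <= G x <= 1.
  apply/andP; split.
    apply: (ler_cvg_to (cvg_cst 0) (GU x)).
    by apply: nearW => mu; have /andP[] := H01 x mu.
  apply: (@ler_cvg_to _ _ _ _ _ (fun=> 1) _ _ (GU x) (cvg_cst _)).
  by apply: nearW => mu; have /andP[] := H01 x mu.
have ndG : {homo G : x y / x <= y}.
  move=> x y xy; apply: (ler_cvg_to (GU x) (GU y)); apply: nearW => mu.
  apply: fine_le; rewrite ?fin_num_measure//; try exact: measurable_sec_le.
  apply: le_measure; rewrite ?inE; try exact: measurable_sec_le.
  by move=> z /= /le_trans; apply.
have H0 mu x : x < 0 -> H mu x = 0.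
  move=> x0; rewrite /H (_ : [set _ | _] = set0) ?measure0//.
  apply/seteqP; split=> z //=; apply/negP; rewrite -ltNge.
  by rewrite (lt_le_trans x0)// circle_sec_ge0.
have H1 mu x : 1 <= x -> H mu x = 1.
  move=> x1; rewrite /H (_ : [set _ | _] = setT) ?probability_setT//.
  by apply/seteqP; split=> z //= _; rewrite (le_trans _ x1)// ltW// circle_sec_lt1.
have G0 x : x < 0 -> G x = 0.
  move=> x0; apply: (cvg_unique _ (GU x)) => //.
  by apply: cvg_near_cst; apply: nearW => mu; rewrite H0.
have G1 x : 1 <= x -> G x = 1.
  move=> x0; apply: (cvg_unique _ (GU x)) => //.
  by apply: cvg_near_cst; apply: nearW => mu; rewrite H1.
have [P PF] := right_limit_probability ndG G0 G1.
pose X : {mfun measurableTypeR R >-> circle R} := circle_proj \o @clamp R.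
pose m : circle_prob R := distribution P X.
exists m; split => //.
apply/wstar_cvgP => f; have cf : continuous f by exact: cts_fun.
pose g (x : R) := f (circle_proj x).
have bf := circle_bounded_measurable cf.
have bg : bounded_measurable (g : measurableTypeR R -> R).
  have [mf [M hM]] := bf; split; last by exists M => x; exact: hM.
  by apply: measurableT_comp.
apply/cvgrPdist_le => e e0.
have e40 : 0 < e / 4 by rewrite divr_gt0.
have [r r0 hr] := circle_uniform_continuous cf e40.
have [n nr] : exists n : nat, r^-1 < n.+1%:R.
  by exists (Num.truncn r^-1); rewrite truncnS_gt.
have ge (x y : R) : `|x - y| <= n.+1%:R^-1 -> `|g x - g y| <= e / 4.
  move=> xy; rewrite ltW// hr// (le_lt_trans xy)//.
  by rewrite invf_plt ?posrE.
have limP : `|\int[m]_z f z - stieltjes_sum g (right_limit G) n| <= e / 4.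
  rewrite Rintegral_distribution//.
  apply: (@stieltjes_sum_dist _ _ _ P (@clamp R) g) => //; first exact: ltW.
    move=> t; rewrite /clamp lt_max ge_max ge_min lexx ler01 /= andbT.
    by rewrite ltrN10.
  move=> x /andP[xm x1].
  have [x0|x0] := ltP x 0.
    rewrite right_limit0// (_ : [set _ | _] = set0) ?measure0//.
    apply/seteqP; split=> t //=; apply/negP; rewrite -ltNge.
    by rewrite (lt_le_trans x0)// /clamp le_max lexx.
  have [{}x1|{}x1] := ltP x 1; last first.
    rewrite right_limit1// (_ : [set _ | _] = setT) ?probability_setT//.
    apply/seteqP; split=> t //= _; rewrite (le_trans _ x1)//.
    by rewrite /clamp ge_max ler01 ge_min lexx.
  rewrite -PF; congr (P _); apply/seteqP; split=> t /=;
    by rewrite /clamp ge_max x0 ge_min leNgt x1.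
have limU (mu : circle_prob R) : `|\int[mu]_z f z - stieltjes_sum g (H mu) n| <= e / 4.
  have -> : \int[mu]_z f z = \int[mu]_z g (circle_sec z).
    by apply: eq_Rintegral => z _; rewrite /g circle_secK.
  apply: (@stieltjes_sum_dist _ _ _ mu (@circle_sec R) g) => //; first exact: ltW.
    move=> t; rewrite (lt_le_trans (ltrN10 R) (circle_sec_ge0 t))/= ltW//.
    exact: circle_sec_lt1.
  move=> x _; rewrite /H fineK// fin_num_measure//; exact: measurable_sec_le.
have limGF : `|stieltjes_sum g (right_limit G) n - stieltjes_sum g G n| <= e / 4.
  apply: stieltjes_sum_limit => //; first exact: ltW.
  - by move=> x; exact: right_limit_ge.
  - by move=> x y; exact: right_limit_le.
  - by rewrite G0// ltrN10.
  - by rewrite right_limit0// ltrN10.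
  - by rewrite G1.
  - by rewrite right_limit1.
have : stieltjes_sum g (H mu) n @[mu --> U] --> stieltjes_sum g G n.
  apply: cvg_big => [|i _]; first exact: add_continuous.
  by apply: cvgM; [exact: cvg_cst|apply: cvgB; exact: GU].
move=> /cvgrPdist_le/(_ _ e40); apply: filterS => mu hmu.
rewrite /integral_map.
move: limP (limU mu) limGF hmu.
set a := \int[_]_z _; set b := stieltjes_sum _ _ _; set c := \int[_]_z _.
set d := stieltjes_sum _ _ _; set d' := stieltjes_sum _ _ _ => h1 h2 h3 h4.
rewrite (_ : a - c = (a - b) + (b - d') + (d' - d) - (c - d)); last by ring.
rewrite (_ : e = e / 4 + e / 4 + e / 4 + e / 4); last by field.
by rewrite (le_trans (ler_normB _ _))// lerD// (le_trans (ler_normD _ _))// lerD//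
  (le_trans (ler_normD _ _))// lerD.
Qed.

End compactness.

(** * Baire category in the space of invariant probabilities *)

Section compact_regular_spaces.

Lemma regular_initial (S : choiceType) (T : topologicalType) (f : S -> T) :
  regular_space T -> regular_space (initial_topology f).
Proof.
move=> rT x A Ax; move: (Ax); rewrite {1}nbhsE => -[_ [[V oV <-] /= Vx] VA].
have [B Bfx BV] := rT (f x) V (open_nbhs_nbhs (conj oV Vx)).
have cf : continuous (f : initial_topology f -> T) by exact: initial_continuous.
exists (f @^-1` B); first exact: (cf x B Bfx).
move=> y yB; apply: VA; apply: BV => C Cy.
have [z [Bz Cz]] := yB (f @^-1` C) (cf _ _ Cy).
by exists (f z).
Qed.

Lemma compact_set_type (T : topologicalType) (K : set T) :
  compact K -> compact [set: K].
Proof.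
move=> cK F FF _.
have [|p [Kp Fp]] := cK (set_val @ F) _.
  by apply: (@filterS _ F _ setT) => [x _|]; [exact: set_valP|exact: filterT].
exists (exist _ p (mem_set Kp)); split=> // A B FA.
rewrite nbhsE => -[_ [[V oV <-] /= Vp] VB].
have FvA : (set_val @ F) (set_val @` A).
  by apply: (@filterS _ F _ A) => // x Ax; exists x.
have [q [[x Ax <-] Vx]] := Fp _ V FvA (open_nbhs_nbhs (conj oV Vp)).
by exists x; split => //; exact: VB.
Qed.

(** The points of the intersection are cluster points of a decreasing sequence
    of open sets [W n], each with its closure in the previous one and in [O n].
    Regularity stands in for a Hausdorff hypothesis, which would fail here: two
    probabilities that agree on Borel sets have the same neighbourhoods and may
    still be different terms. *)
Lemma compact_regular_Baire (T : topologicalType) (O : (set T)^nat) :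
  compact [set: T] -> regular_space T ->
  (forall n, open (O n)) -> (forall n, dense (O n)) -> dense (\bigcap_n O n).
Proof.
move=> cT rT oO dO U [x0 Ux0] oU.
pose S := {V : set T | open V /\ V !=set0}.
have step n (V : S) : exists W : S, closure (sval W) `<=` sval V `&` O n.
  case: V => V [oV V0] /=.
  have [y [Vy Oy]] := dO n V V0 oV.
  have [|B By BV] := rT y (V `&` O n).
    by apply: open_nbhs_nbhs; split => //; exact: openI.
  have [W [oW Wy] WB] : exists2 W, open_nbhs y W & W `<=` B by move: By; rewrite nbhsE.
  exists (exist _ W (conj oW (ex_intro _ y Wy))) => /=.
  by apply: subset_trans BV; exact: closure_subset.
have [h hP] := choice (fun nV : nat * S => step nV.1 nV.2).
pose W := fix W n : S := if n is n'.+1 then h (n', W n')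
  else exist _ U (conj oU (ex_intro _ x0 Ux0)).
have WS n : closure (sval (W n.+1)) `<=` sval (W n) `&` O n by exact: hP (n, W n).
have Wd n k : sval (W (k + n)%N) `<=` sval (W n).
  elim: k => [|k IH] //; rewrite addSn => y Wy.
  by apply: IH; have [] := WS (k + n)%N y (subset_closure Wy).
pose F := filter_from [set: nat] (fun n => sval (W n)).
have FF : ProperFilter F.
  apply: filter_from_proper; last by move=> n _; exact: (svalP (W n)).2.
  apply: filter_from_filter; first by exists 0%N.
  move=> i j _ _; exists (i + j)%N => // y Wy; split.
    by apply: (Wd _ j); rewrite addnC.
  exact: (Wd _ i).
have [|p [_ Fp]] := cT F FF; first exact: filterT.
have Wp n : closure (sval (W n)) p by move=> B Bp; apply: Fp => //; exists n.
exists p; split.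
  by have [] := WS 0%N p (Wp 1%N).
by move=> n _; have [] := WS n p (Wp n.+1).
Qed.

End compact_regular_spaces.

Section wstar_space.
Context {R : realType}.
Implicit Types (f : circle R -> R) (mu nu : circle_prob R).

Lemma circle_prob_regular : regular_space (circle_prob R).
Proof. by apply: regular_initial; exact: uniform_regular. Qed.

Lemma integral_continuous f : continuous f ->
  continuous (fun mu : circle_prob R => \int[mu]_x f x : R).
Proof.
move=> cf mu.
pose F : continuousType (circle R) R := HB.pack f (isContinuous.Build _ _ f cf).
by have /wstar_cvgP := @cvg_id _ (nbhs mu); move=> /(_ F).
Qed.

Lemma circle_mul_comp_continuous f (m : int) : continuous f ->
  continuous (fun z => f (circle_mul m z)).
Proof.
by move=> cf z; apply: continuous_comp; [exact: circle_mul_continuous|exact: cf].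
Qed.

Lemma integral_times_push f (m : int) mu : continuous f ->
  \int[times_push m mu]_x f x = \int[mu]_x f (circle_mul m x).
Proof.
by move=> cf; rewrite Rintegral_distribution//; exact: circle_bounded_measurable.
Qed.

(** In this form invariance is visibly a weak-star closed condition. *)
Lemma invariant_probP (p : nat) mu : invariant_prob p mu <->
  forall f, continuous f -> \int[mu]_x f (circle_mul p%:Z x) = \int[mu]_x f x.
Proof.
split=> [im f cf|h A mA].
  rewrite -integral_times_push//; congr fine.
  by apply: eq_measure_integral => A mA _; exact: im.
by apply: circle_prob_unique => // f cf; rewrite integral_times_push// h.
Qed.

Lemma invariant_prob_closed (p : nat) : closed (@invariant_prob R p).
Proof.
rewrite (_ : invariant_prob p = \bigcap_(f in [set f : circle R -> R | continuous f])
   [set mu | \int[mu]_x f (circle_mul p%:Z x) - \int[mu]_x f x = 0]).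
  apply: closed_bigI => f cf.
  apply: (@closed_comp _ _ (fun mu : circle_prob R =>
    \int[mu]_x f (circle_mul p%:Z x) - \int[mu]_x f x : R) [set 0]).
    move=> mu _; exact: (cvgB (integral_continuous
      (@circle_mul_comp_continuous f p%:Z cf) (x0 := mu)) (integral_continuous cf (x0 := mu))).
  exact: closed_eq.
apply/seteqP; split=> mu.
  by move=> /invariant_probP h f cf; rewrite /= h// subrr.
by move=> h; apply/invariant_probP => f cf; apply/eqP; rewrite -subr_eq0 h.
Qed.

Lemma invariant_prob_Baire (p : nat) (O : (set (@invariant_prob R p))^nat) :
  (forall n, open (O n)) -> (forall n, dense (O n)) -> dense (\bigcap_n O n).
Proof.
apply: compact_regular_Baire.
  apply: compact_set_type; rewrite -[X in compact X]setTI.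
  by apply: compact_closedI; [exact: circle_prob_compact|exact: invariant_prob_closed].
by apply: regular_initial; exact: circle_prob_regular.
Qed.

End wstar_space.

(** * Rounding an invariant probability to a periodic one *)

Section rounding.
Context {R : realType}.
Implicit Types (f g : circle R -> R) (mu nu lam : circle_prob R).

Lemma circle_mul_ratio (m n : int) (q : nat) :
  circle_mul m (circle_proj (n%:~R / q%:R : R)) = circle_proj ((m * n)%:~R / q%:R).
Proof. by rewrite circle_mul_proj -mulrzl intrM mulrA. Qed.

Lemma circle_proj_ratio_eq (m n : int) (q : nat) : (0 < q)%N ->
  (q%:Z %| m - n)%Z ->
  circle_proj (m%:~R / q%:R : R) = circle_proj (n%:~R / q%:R).
Proof.
move=> q0 /dvdzP[d mn]; apply/circle_proj_eq; rewrite -mulrBl -intrB mn intrM.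
by rewrite mulfK ?intr_int// pnatr_eq0 -lt0n.
Qed.

Definition round_shift (q r : nat) (x : measurableTypeR R) : measurableTypeR R :=
  (Num.floor (q%:R * (x : R)) + r%:Z)%:~R / q%:R.

Lemma round_shift_measurable q r : measurable_fun setT (round_shift q r).
Proof.
apply: nondecreasing_measurable => // x y xy.
by rewrite /round_shift ler_wpM2r ?invr_ge0// ler_int lerD2r le_floor// ler_wpM2l.
Qed.

HB.instance Definition _ q r :=
  isMeasurableFun.Build _ _ _ _ (round_shift q r) (round_shift_measurable q r).

Lemma round_shift_dist q r (x : R) : (0 < q)%N ->
  `|round_shift q r x - x| <= r.+1%:R / q%:R.
Proof.
move=> q0; have q0' : 0 < q%:R :> R by rewrite ltr0n.
rewrite ler_pdivlMr// -{1}(gtr0_norm q0') -normrM mulrBl /round_shift.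
rewrite divfK ?gt_eqF// intrD/=.
have /andP[] := floor_itv (q%:R * x); set n : R := (Num.floor _)%:~R.
rewrite intrD -/n -natr1 -[r%:~R]/(r%:R) => h1 h2.
have r0 : 0 <= r%:R :> R by [].
by rewrite ler_norml; move: h1 h2 r0; set s : R := r%:R; set t := q%:R * x;
   rewrite [x * _]mulrC -/t => *; lra.
Qed.

Definition round_circle (q r : nat) : {mfun circle R >-> circle R} :=
  circle_proj \o (round_shift q r \o @circle_sec R).

Lemma round_circleE q r z : round_circle q r z =
  circle_proj ((Num.floor (q%:R * (circle_sec z : R)) + r%:Z)%:~R / q%:R).
Proof. by []. Qed.

(** [orbit_average p k lam] is the mean of the images of [lam] under [T_(p^i)],
    [i <= k]; it is invariant as soon as [T_(p^(k+1))] fixes [lam]. *)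
Definition orbit_average (p k : nat) (lam : circle_prob R) : circle_prob R :=
  average k (fun i => times_push (p ^ i)%N%:Z lam).

(** Rounding to the multiples of [1/q], followed by a shift of [s/q] with [s]
    uniform in [0, ..., r]. *)
Definition rounding (q r : nat) mu : circle_prob R :=
  average r (fun s => distribution mu (round_circle q s)).

Lemma integral_orbit_average p k lam f : continuous f ->
  \int[orbit_average p k lam]_z f z =
  k.+1%:R^-1 * \sum_(i < k.+1) \int[lam]_z f (circle_mul (p ^ i)%N%:Z z).
Proof.
move=> cf; rewrite Rintegral_average; last exact: circle_bounded_measurable.
by congr (_ * _); apply: eq_bigr => i _; rewrite integral_times_push.
Qed.

Lemma integral_rounding q r mu f : continuous f ->
  \int[rounding q r mu]_z f z =
  r.+1%:R^-1 * \sum_(s < r.+1) \int[mu]_z f (round_circle q s z).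
Proof.
move=> cf; have bf := circle_bounded_measurable cf.
rewrite Rintegral_average//; congr (_ * _); apply: eq_bigr => i _.
by rewrite Rintegral_distribution.
Qed.

Lemma circle_mulM (m n : int) (z : circle R) :
  circle_mul m (circle_mul n z) = circle_mul (m * n) z.
Proof. by rewrite /circle_mul -mulrzA mulrC. Qed.

(** Applying [T_p] shifts the sum by one index, and the new last term equals
    the old first one. *)
Lemma orbit_average_invariant p k lam :
  (forall f, continuous f ->
    \int[lam]_z f (circle_mul (p ^ k.+1)%N%:Z z) = \int[lam]_z f z) ->
  invariant_prob p (orbit_average p k lam).
Proof.
move=> per; apply/invariant_probP => f cf.
rewrite !integral_orbit_average//; last exact: circle_mul_comp_continuous.
congr (_ * _); rewrite big_ord_recr [RHS]big_ord_recl/= addrC; congr (_ + _).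
  rewrite -[RHS](_ : \int[lam]_z f (circle_mul (p ^ k.+1)%N%:Z z) = _); last first.
    by rewrite per// expn0; apply: eq_Rintegral => z _; rewrite /circle_mul mulr1z.
  by apply: eq_Rintegral => z _; rewrite circle_mulM -PoszM -expnS.
apply: eq_bigr => i _; apply: eq_Rintegral => z _.
by rewrite circle_mulM -PoszM -expnS.
Qed.

(** Rounding puts all the mass on the multiples of [1/q], a set stable under
    every [T_m]. *)
Lemma orbit_average_rounding_eq p k q r mu f g :
  continuous f -> continuous g ->
  (forall n : int, f (circle_proj (n%:~R / q%:R)) = g (circle_proj (n%:~R / q%:R))) ->
  \int[orbit_average p k (rounding q r mu)]_z f z =
  \int[orbit_average p k (rounding q r mu)]_z g z.
Proof.
move=> cf cg fg; rewrite !integral_orbit_average//; congr (_ * _).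
apply: eq_bigr => i _.
rewrite !integral_rounding//; try exact: circle_mul_comp_continuous.
congr (_ * _); apply: eq_bigr => s _; apply: eq_Rintegral => z _.
by rewrite round_circleE circle_mul_ratio.
Qed.

Lemma rounding_periodic (p k q r : nat) mu f : (0 < q)%N -> (0 < p)%N ->
  (q %| (p ^ k).-1)%N -> continuous f ->
  \int[rounding q r mu]_z f (circle_mul (p ^ k)%N%:Z z) = \int[rounding q r mu]_z f z.
Proof.
move=> q0 p0 qp cf; rewrite !integral_rounding//; last exact: circle_mul_comp_continuous.
congr (_ * _); apply: eq_bigr => s _; apply: eq_Rintegral => z _.
rewrite round_circleE circle_mul_ratio; congr (f _); apply: circle_proj_ratio_eq => //.
set n := (Num.floor _ + _).
rewrite -[X in _ - X]mul1r -mulrBl dvdz_mulr//.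
have -> : (p ^ k)%N%:Z - 1 = (p ^ k).-1%:Z.
  by rewrite -subn1 -subzn ?expn_gt0 ?p0.
exact: qp.
Qed.

(** A tent of height 1 and half-width [1/q] centred at [j/q]. *)
Definition circle_bump (q : nat) (j : int) (z : circle R) : R :=
  Num.max 0 (1 - q%:R * circle_norm (z - circle_proj (j%:~R / q%:R))).

Lemma circle_bump_continuous q j : continuous (circle_bump q j).
Proof.
apply: (@circle_lip_continuous _ _ q%:R) => z w; rewrite /circle_bump.
set y := circle_proj _.
have h : circle_norm (w - y) <= circle_norm (z - y) + circle_norm (z - w).
  by rewrite -[circle_norm (z - w)]circle_normN opprB [leRHS]addrC -[w - y](subrKA z) circle_normD.
have := ler_wpM2l (ler0n R q) h; rewrite mulrDr.
have : 0 <= q%:R * circle_norm (z - w) by rewrite mulr_ge0// circle_norm_ge0.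
rewrite /Num.max; case: ifPn; rewrite -?leNgt => h1; case: ifPn; rewrite -?leNgt => h2;
  by move: h1 h2; set a := _ * _; set b := _ * _; set c := _ * _ => *; lra.
Qed.

Lemma circle_bump_ge0 q j z : 0 <= circle_bump q j z.
Proof. by rewrite /circle_bump le_max lexx. Qed.

Lemma circle_bump_le1 q j z : circle_bump q j z <= 1.
Proof.
by rewrite /circle_bump ge_max ler01 gerBl mulr_ge0// circle_norm_ge0.
Qed.

Lemma circle_bump_ratio q (j n : int) : (0 < q)%N -> ~~ (q%:Z %| n - j)%Z ->
  circle_bump q j (circle_proj (n%:~R / q%:R)) = 0.
Proof.
move=> q0 qnj; apply/max_idPl; rewrite subr_le0 -circle_projB -mulrBl -intrB.
have q0' : 0 < q%:R :> R by rewrite ltr0n.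
rewrite circle_norm_proj /dist_int; set t := Num.floor _.
rewrite -{1}(gtr0_norm q0') -normrM mulrBr mulrC divfK ?gt_eqF//.
rewrite -[q%:R]/(q%:Z%:~R) -intrM -intrB -intr_norm -[1]/(1%:~R) ler_int.
rewrite -gtz0_ge1 normr_gt0; apply: contraNneq qnj => /eqP; rewrite subr_eq0 => /eqP ->.
exact: dvdz_mulr.
Qed.

Lemma sum_one_nonzero_le1 (n : nat) (u : 'I_n -> R) : (forall i, 0 <= u i <= 1) ->
  (forall i j, u i != 0 -> u j != 0 -> i = j) -> \sum_i u i <= 1.
Proof.
move=> u01 uij; have [/existsP[i ui]|] := boolP [exists i, u i != 0].
  rewrite (bigD1 i)//= big1 ?addr0; first by have /andP[] := u01 i.
  move=> j ji; apply/eqP; apply: contraNT ji => uj.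
  by rewrite (uij _ _ uj ui).
rewrite negb_exists => /forallP h; rewrite big1// => i _.
by have := h i; rewrite negbK => /eqP.
Qed.

(** Among the multiples of [1/q] the tent at [j/q] only sees [j/q] itself.
    Since [p] is invertible modulo [q] and [r < q], for given [x] and [i] at
    most one of the [r + 1] shifts leads to that point. *)
Lemma integral_bump_le p k q r mu (j : int) :
  coprime q p -> (r < q)%N ->
  \int[orbit_average p k (rounding q r mu)]_z circle_bump q j z <= r.+1%:R^-1.
Proof.
move=> qp rq; have q0 : (0 < q)%N by exact: leq_ltn_trans rq.
have cb := @circle_bump_continuous q j.
rewrite integral_orbit_average//.
have bk (i : nat) : \int[rounding q r mu]_z circle_bump q j (circle_mul (p ^ i)%N%:Z z)
    <= r.+1%:R^-1.
  rewrite integral_rounding; last exact: circle_mul_comp_continuous.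
  rewrite -[leRHS]mulr1 ler_wpM2l ?invr_ge0//.
  pose F (s : nat) z := circle_bump q j (circle_mul (p ^ i)%N%:Z (round_circle q s z)).
  have bF s : bounded_measurable (F s).
    have [mb _] := circle_bounded_measurable (@circle_mul_comp_continuous _ _ (p ^ i)%N%:Z cb).
    split; first exact: measurableT_comp mb _.
    by exists 1 => z; rewrite ger0_norm ?circle_bump_ge0// circle_bump_le1.
  have [bS <-] := Rintegral_bm_sum mu r.+1 bF.
  rewrite -[leRHS](Rintegral_prob_cst mu); apply: Rintegral_bm_le => //.
    exact: bounded_measurable_cst.
  move=> z; apply: sum_one_nonzero_le1 => [s|s s' us us'].
    by rewrite /F circle_bump_ge0 circle_bump_le1.
  have h (t : 'I_r.+1) : F t z != 0 -> (q%:Z %|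
      (p ^ i)%N%:Z * (Num.floor (q%:R * (circle_sec z : R)) + t%:Z) - j)%Z.
    move=> Ft; apply: contraNT Ft => Ft.
    by rewrite /F round_circleE circle_mul_ratio circle_bump_ratio.
  have := rpredB (h _ us) (h _ us').
  rewrite opprB addrA subrK -mulrBr opprD addrACA subrr add0r.
  rewrite Gauss_dvdzr; last by rewrite coprimezE/= coprimeXr.
  move=> qs; apply/val_inj/eqP; rewrite -eqz_nat -subr_eq0.
  apply: contraTT qs => ss; rewrite dvdzE/=.
  have := ltn_ord s; have := ltn_ord s' => s1 s2.
  rewrite gtnNdvd ?absz_gt0//; lia.
rewrite ler_pdivrMl ?ltr0n//.
apply: (@le_trans _ _ (\sum_(i < k.+1) r.+1%:R^-1)).
  by apply: ler_sum => i _; exact: bk.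
by rewrite sumr_const card_ord mulr_natl.
Qed.

End rounding.

(** * The rounded probabilities converge to the original one *)

Section closeness.
Context {R : realType}.
Implicit Types (f g : circle R -> R) (mu nu lam : circle_prob R).

(** The number of indices [i <= k] for which the factor [p ^ i] is so large that
    the rounding error is out of control. *)
Lemma count_late_indices (k l : nat) :
  (\sum_(i < k.+1) (k < i + l) = minn l k.+1)%N.
Proof.
elim: k => [|k IH]; first by rewrite big_ord1 /=; lia.
rewrite big_ord_recl add0n (eq_bigr (fun i : 'I_k.+1 => (k < i + l) : nat)).
  by rewrite IH; lia.
by move=> i _; rewrite lift0 addSn.
Qed.

Lemma integral_invariant_iter p mu f i : invariant_prob p mu -> continuous f ->
  \int[mu]_z f (circle_mul (p ^ i)%N%:Z z) = \int[mu]_z f z.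
Proof.
move=> /invariant_probP im cf; elim: i => [|i IH].
  by rewrite expn0; apply: eq_Rintegral => z _; rewrite /circle_mul mulr1z.
rewrite -IH -(im (fun z => f (circle_mul (p ^ i)%N%:Z z))); last exact: circle_mul_comp_continuous.
by apply: eq_Rintegral => z _; rewrite circle_mulM -PoszM -expnSr.
Qed.

Lemma round_shift_iter_dist (p q i r s : nat) (x : R) : (0 < q)%N -> (s <= r)%N ->
  `|round_shift q s x *~ (p ^ i)%N%:Z - x *~ (p ^ i)%N%:Z|
    <= (p ^ i)%:R * r.+1%:R / q%:R.
Proof.
move=> q0 sr; rewrite -mulrzBl -mulrzl normrM -mulrA ger0_norm; last by [].
apply: ler_wpM2l; first by [].
apply: (le_trans (round_shift_dist s x q0)); apply: ler_wpM2r.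
  by rewrite invr_ge0.
by rewrite ler_nat ltnS.
Qed.

Lemma average_dist (n : nat) (u v b : nat -> R) :
  (forall i, (i <= n)%N -> `|u i - v i| <= b i) ->
  `|n.+1%:R^-1 * (\sum_(i < n.+1) u i) - n.+1%:R^-1 * \sum_(i < n.+1) v i|
    <= n.+1%:R^-1 * \sum_(i < n.+1) b i.
Proof.
move=> uv; rewrite -mulrBr -sumrB normrM ger0_norm ?invr_ge0//.
rewrite ler_wpM2l ?invr_ge0// (le_trans (ler_norm_sum _ _ _))//.
by apply: ler_sum => i _; apply: uv; have := ltn_ord i; rewrite ltnS.
Qed.

Lemma average_cst (n : nat) (x : R) : n.+1%:R^-1 * (\sum_(i < n.+1) x) = x.
Proof. by rewrite sumr_const card_ord -[x *+ _]mulr_natl mulKf ?pnatr_eq0. Qed.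

(** Compare term by term with [mu], the mean of its own images under [T_(p^i)].
    With [q >= p ^ k], the rounding error after [T_(p^i)] is at most
    [(r + 1) / p ^ (k - i)]: below the modulus of continuity [d] of [f] when
    [i + l <= k], where [l] depends on [r] and [d] only. The at most [l]
    remaining terms, each bounded by [2 * M], disappear in the mean. *)
Lemma orbit_average_rounding_dist p r mu f (e : R) :
  (1 < p)%N -> invariant_prob p mu -> continuous f -> 0 < e ->
  exists k0, forall k, (k0 <= k)%N ->
    `|\int[orbit_average p k (rounding (repunit p k.+1) r mu)]_z f z
      - \int[mu]_z f z| <= e.
Proof.
move=> p1 im cf e0; have e20 : 0 < e / 2 by rewrite divr_gt0.
have bf := circle_bounded_measurable cf.
have [M M0 fM] : exists2 M : R, 0 <= M & forall z, `|f z| <= M.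
  have [_ [M hM]] := bf; exists M => //.
  by rewrite (le_trans _ (hM 0)).
have [d d0 fd] := circle_uniform_continuous cf e20.
have [l hl] : exists l : nat, r.+1%:R / d < (2 ^ l)%:R :> R.
  exists (Num.truncn (r.+1%:R / d)).+1; rewrite (lt_trans (truncnS_gt _))//.
  by rewrite ltr_nat ltn_expl.
(* from this rank on, [l] terms of size [2 * M] contribute at most [e / 2] *)
exists (Num.truncn (4 * M * l%:R / e)) => k k0.
set q := repunit p k.+1; have pq : (p ^ k <= q)%N by exact: repunit_ge.
have q0 : (0 < q)%N by rewrite (leq_trans _ pq)// expn_gt0 (ltnW p1).
pose b (i : nat) : R := if (i + l <= k)%N then e / 2 else M + M.
have close (i s : nat) z : (s <= r)%N ->
    `|f (circle_mul (p ^ i)%N%:Z (round_circle q s z)) - f (circle_mul (p ^ i)%N%:Z z)|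
      <= b i.
  move=> sr; rewrite /b; case: ifPn => il; last first.
    by rewrite (le_trans (ler_normB _ _))// lerD.
  rewrite -{2}(circle_secK z) round_circleE !circle_mul_proj ltW// fd//.
  rewrite (le_lt_trans (@round_shift_iter_dist p q i r s _ q0 sr))//.
  rewrite ltr_pdivrMr ?ltr0n//; move: hl; rewrite ltr_pdivrMr// => hl.
  apply: (@lt_le_trans _ _ ((p ^ i)%:R * ((2 ^ l)%:R * d))).
    by rewrite ltr_pM2l// ltr0n expn_gt0 (ltnW p1).
  rewrite mulrA [leLHS]mulrC ler_wpM2l ?(ltW d0)// -natrM ler_nat.
  rewrite (leq_trans _ pq)// (leq_trans _ (leq_pexp2l (ltnW p1) il))//.
  rewrite expnD leq_mul//; case: (l) => // l0; by rewrite leq_exp2r.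
rewrite integral_orbit_average//.
rewrite -[X in `|_ - X|](average_cst k).
pose u (i : nat) := \int[rounding q r mu]_z f (circle_mul (p ^ i)%N%:Z z).
apply: (@le_trans _ _ (k.+1%:R^-1 * \sum_(i < k.+1) b i)).
  apply: (@average_dist k u (fun=> \int[mu]_z f z)) => i _.
  have cfi := @circle_mul_comp_continuous _ f (p ^ i)%N%:Z cf.
  have [mfi bfi] := circle_bounded_measurable cfi.
  rewrite /u integral_rounding// -[X in `|_ - X|](average_cst r) -[leRHS](average_cst r).
  pose w (s : nat) := \int[mu]_z f (circle_mul (p ^ i)%N%:Z (round_circle q s z)).
  apply: (@average_dist r w (fun=> \int[mu]_z f z) (fun=> b i)) => s sr.
  rewrite -(integral_invariant_iter i im cf); apply: Rintegral_bm_dist => //.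
    split; first exact: measurableT_comp mfi _.
    by have [N hN] := bfi; exists N => z; exact: hN.
  by move=> z; exact: close.
apply: (@le_trans _ _ (k.+1%:R^-1 * \sum_(i < k.+1) (e / 2 + (k < i + l)%:R * (M + M)))).
  rewrite ler_wpM2l ?invr_ge0//; apply: ler_sum => i _; rewrite /b ltnNge.
  case: ifPn => _; first by rewrite mul0r addr0.
  by rewrite mul1r lerDr ltW.
rewrite big_split/= mulrDr average_cst -mulr_suml -natr_sum count_late_indices.
rewrite [leRHS]splitr lerD2l mulrC ler_pdivrMr ?ltr0n//.
apply: (@le_trans _ _ (l%:R * (M + M))).
  by rewrite ler_wpM2r ?addr_ge0// ler_nat geq_minl.
have : 4 * M * l%:R / e <= k.+1%:R.
  by rewrite ltW// (lt_le_trans (truncnS_gt _))// ler_nat ltnS.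
by rewrite ler_pdivrMr//; lra.
Qed.

End closeness.

(** * A test function, and a criterion for the absence of atoms *)

Section generic_properties.
Context {R : realType}.
Implicit Types (f g : circle R -> R) (mu nu lam : circle_prob R).

Lemma circle_norm_continuous : continuous (@circle_norm R).
Proof.
apply: (@circle_lip_continuous _ _ 1) => z w.
by rewrite mul1r -{1}(subrK w z) addrC circle_normD.
Qed.

(** On [[1/4, 3/4]] the distance to the nearest integer is at least [1/4]. *)
Lemma integral_norm_leb_gt0 : 0 < \int[@circle_leb R]_z circle_norm z.
Proof.
have bN := circle_bounded_measurable circle_norm_continuous.
have bd : bounded_measurable (@dist_int R : measurableTypeR R -> R).
  have [mN [M hM]] := bN; split.
    rewrite (_ : @dist_int R = @circle_norm R \o circle_proj).
      exact: measurableT_comp mN _.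
    by apply/funext => x /=; rewrite circle_norm_proj.
  by exists M => x; rewrite -circle_norm_proj.
rewrite Rintegral_distribution// (_ : (fun x => _) = @dist_int R); last first.
  by apply/funext => x; rewrite circle_norm_proj.
rewrite -lte_fin /Rintegral fineK; last first.
  by apply: integrable_fin_num => //; exact: bounded_measurable_integrable.
have md : measurable_fun setT (EFin \o @dist_int R).
  by apply/measurable_EFinP; case: bd.
rewrite integral_uniform//; last by move=> x; rewrite lee_fin normr_ge0.
rewrite subr0 invr1 mul1e.
have sub : [set` `[(4^-1 : R), 3 / 4]] `<=` [set` `[(0 : R), 1]].
  by move=> x /=; rewrite !in_itv/= => /andP[? ?]; apply/andP; split; lra.
have h1 : (0%:E < \int[lebesgue_measure]_(x in `[(4^-1 : R)%R, (3 / 4)%R]) (4^-1)%R%:E)%E.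
  rewrite integral_cst//= lebesgue_measure_itv/= lte_fin ifT; last by lra.
  by rewrite -EFinB -EFinM lte_fin; lra.
have h2 : (\int[lebesgue_measure]_(x in `[(4^-1 : R)%R, (3 / 4)%R]) (4^-1)%R%:E <=
    \int[lebesgue_measure]_(x in `[(4^-1 : R)%R, (3 / 4)%R]) (dist_int x)%:E)%E.
  apply: ge0_le_integral => //.
  - by apply: measurable_funTS.
  - move=> x /=; rewrite in_itv/= => /andP[x1 x2]; rewrite lee_fin /dist_int.
    set m := Num.floor _.
    have [m0|m1] := leP m 0.
      have : m%:~R <= 0 :> R by rewrite -[0]/(0%:~R) ler_int.
      by move=> h; rewrite (le_trans _ (ler_norm _))//; lra.
    have : 1 <= m%:~R :> R by rewrite -[1]/(1%:~R) ler_int.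
    by move=> h; rewrite -normrN (le_trans _ (ler_norm _))//; lra.
have h3 : (\int[lebesgue_measure]_(x in `[(4^-1 : R)%R, (3 / 4)%R]) (dist_int x)%:E <=
    \int[lebesgue_measure]_(x in `[(0 : R)%R, 1%R]) (dist_int x)%:E)%E.
  apply: ge0_subset_integral => //; first by apply: measurable_funTS.
  by move=> x _; rewrite lee_fin normr_ge0.
exact: lt_le_trans h1 (le_trans h2 h3).
Qed.

(** Density in [K] is proved by approximating sequences: [A] only has to
    contain their terms from some rank on. *)
Lemma dense_invariant (p : nat) (A : set (circle_prob R)) :
  (forall mu, invariant_prob p mu -> exists nu : (circle_prob R)^nat,
    [/\ nu @ \oo --> mu, forall n, invariant_prob p (nu n) &
        \forall n \near \oo, A (nu n)]) ->
  dense (set_val @^-1` A : set (@invariant_prob R p)).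
Proof.
move=> h U [[mu mup] Umu] [V oV VU].
have [nu [numu nup nuA]] := h mu (set_mem mup).
have nuV : \forall n \near \oo, V (nu n).
  apply: (numu V); apply: open_nbhs_nbhs; split => //.
  by move: Umu; rewrite -VU.
have [n [An Vn]] := filter_ex (filterI nuA nuV).
exists (exist _ (nu n) (mem_set (nup n))); split => //.
by rewrite -VU.
Qed.

(** A weak-star open condition that bounds the masses of all points by [2 * e]:
    every point is within [1 / (2 * M)] of some [j / M], where the tent is at
    least [1/2]. The index [j = M] is the point 0 again; including it avoids a
    reduction modulo [M]. *)
Definition small_bumps (e : R) : set (circle_prob R) :=
  [set mu | exists M : nat, (0 < M)%N /\
    forall j : 'I_M.+1, \int[mu]_z circle_bump M j z < e].

Lemma open_integral_lt f (e : R) : continuous f ->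
  open [set mu : circle_prob R | \int[mu]_x f x < e].
Proof.
move=> cf; apply: (@open_comp _ _ (fun mu : circle_prob R => \int[mu]_x f x : R)
  [set x | x < e]); last exact: open_lt.
by move=> mu _; exact: integral_continuous.
Qed.

Lemma small_bumps_open e : open (small_bumps e).
Proof.
rewrite openE => mu [M [M0 hM]]; rewrite /interior.
have : nbhs mu [set nu : circle_prob R |
    forall j : 'I_M.+1, \int[nu]_z circle_bump M j z < e].
  apply: (@filter_forall _ _ (fun (j : 'I_M.+1) (nu : circle_prob R) =>
    \int[nu]_z circle_bump M j z < e) (nbhs mu) _) => j; apply: open_nbhs_nbhs; split; last exact: hM.
  by apply: open_integral_lt; exact: circle_bump_continuous.
by apply: filterS => nu h; exists M.
Qed.

Lemma small_bumps_atom_free mu :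
  (forall N : nat, small_bumps N.+1%:R^-1 mu) -> atom_free mu.
Proof.
move=> h x.
have mx : measurable [set x].
  have cN : continuous (fun z : circle R => circle_norm (z - x)).
    apply: (@circle_lip_continuous R (fun z : circle R => circle_norm (z - x)) 1) => z w.
    by rewrite mul1r [leRHS]addrC -(subrKA w z (- x)) circle_normD.
  have [mN _] := circle_bounded_measurable cN.
  rewrite -[[set x]]setTI (_ : [set x] = (fun z : circle R => circle_norm (z - x)) @^-1` [set 0]).
    exact: mN.
  apply/seteqP; split=> z /=; first by move->; rewrite subrr circle_norm0.
  by move/circle_norm_eq0/subr0_eq.
have fx : mu [set x] = (\int[mu]_z (\1_[set x] z : R))%:E.
  by rewrite /Rintegral integral_indic// setIT fineK// fin_num_measure.
have bI : bounded_measurable (\1_[set x] : circle R -> R).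
  split; first exact: measurable_indic.
  by exists 1 => z; rewrite indicE ger0_norm//; case: (_ \in _); rewrite ?ler01.
rewrite fx; congr EFin; apply/eqP; rewrite eq_le; apply/andP; split; last first.
  by apply: Rintegral_ge0 => z _; rewrite indicE.
apply/ler_addgt0Pr => e e0; rewrite add0r.
(* the mass of [x] is at most [2 / (N + 1)] *)
pose N := Num.truncn (2 / e).
have Ne : N.+1%:R^-1 < e / 2.
  by rewrite invf_plt ?posrE// ?divr_gt0// invf_div truncnS_gt.
have [M [M0 hM]] := h N.
have M0' : 0 < M%:R :> R by rewrite ltr0n.
pose j := Num.floor (M%:R * (circle_sec x : R) + 2^-1).
have j0 : 0 <= j.
  by rewrite floor_ge0 addr_ge0// ?invr_ge0// mulr_ge0// circle_sec_ge0.
have jM : (`|j| < M.+1)%N.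
  rewrite -ltz_nat gez0_abs// floor_lt_int -[M.+1%:~R]/(M.+1%:R) -[M.+1%:R]natr1.
  have := circle_sec_lt1 x; rewrite -(ltr_pM2l M0') mulr1.
  by set t := _ * _; set s : R := M%:R => *; lra.
have := hM (Ordinal jM); rewrite /= gez0_abs// => hj.
rewrite -[leRHS](divfK (x := 2)) ?pnatr_eq0//.
apply: (@le_trans _ _ (2 * \int[mu]_z circle_bump M j z)); last first.
  by rewrite mulrC ler_pM2r//; exact: ltW (lt_trans hj Ne).
have bb := circle_bounded_measurable (@circle_bump_continuous R M j).
rewrite -RintegralZl//; last exact: bounded_measurable_integrable.
apply: Rintegral_bm_le => //; first exact: bounded_measurableZ.
move=> z; rewrite indicE; have [|] := boolP (z \in [set x]); last first.
  by move=> _; rewrite mulr_ge0// circle_bump_ge0.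
rewrite inE => -> /=; rewrite -ler_pdivrMl// /circle_bump le_max; apply/orP; right.
rewrite mulr1 lerBrDl -lerBrDr.
suff : M%:R * circle_norm (x - circle_proj (j%:~R / M%:R)) <= 2^-1 :> R by lra.
rewrite -{1}(circle_secK x) -circle_projB.
apply: (@le_trans _ _ (M%:R * `|circle_sec x - j%:~R / M%:R|)).
  by rewrite ler_wpM2l// circle_norm_le.
rewrite -{1}(gtr0_norm M0') -normrM mulrBr [M%:R * (_ / _)]mulrC divfK ?gt_eqF//.
have /andP[] := floor_itv (M%:R * (circle_sec x : R) + 2^-1); rewrite -/j intrD.
by rewrite ler_norml; set t := _ * _; set s : R := j%:~R => *; lra.
Qed.

End generic_properties.

(** * The dense open conditions *)

Section dense_open_sets.
Context {R : realType}.
Implicit Types (f g : circle R -> R) (mu nu lam : circle_prob R).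

Definition integral_neq f (l : R) : set (circle_prob R) :=
  [set mu | \int[mu]_z f z != l].

Lemma integral_neq_open f l : continuous f -> open (integral_neq f l).
Proof.
move=> cf; apply: (@open_comp _ _ (fun mu : circle_prob R => \int[mu]_x f x : R)
  [set x | x != l]); last exact: open_neq.
by move=> mu _; exact: integral_continuous.
Qed.

(** If the integral of [f] equals [l], mixing in the Dirac mass at 0 with weight
    [t] changes it by [t * (f 0 - l)]. The Dirac mass at 0 is invariant. *)
Lemma integral_neq_dense (p : nat) f l : continuous f -> f 0 != l ->
  dense (set_val @^-1` integral_neq f l : set (@invariant_prob R p)).
Proof.
move=> cf f0l; apply: dense_invariant => mu im.
have [fl|fl] := eqVneq (\int[mu]_z f z) l; last first.
  by exists (fun=> mu); split => //; [exact: cvg_cst|exact: nearW].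
pose d0 : circle_prob R := \d_(0 : circle R).
pose t (n : nat) := Itv01 (proj1 (andP (avg_weight R n))) (proj2 (andP (avg_weight R n))).
pose nu n : circle_prob R := mixture (t n) mu d0.
have d0E g : continuous g -> \int[d0]_z g z = g 0.
  move=> cg; rewrite /Rintegral integral_dirac//=.
    by rewrite indicT mul1r.
  by apply/measurable_EFinP; have [] := circle_bounded_measurable cg.
have nuE n g : continuous g -> \int[nu n]_z g z =
    (1 - n.+1%:R^-1) * \int[mu]_z g z + n.+1%:R^-1 * g 0.
  by move=> cg; rewrite Rintegral_mixture ?d0E//; exact: circle_bounded_measurable.
exists nu; split.
- apply/wstar_cvgP => g; have cg : continuous g by exact: cts_fun.
  suff : \int[nu n]_z g z @[n --> \oo] --> \int[mu]_z g z by [].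
  rewrite (_ : (fun n => \int[nu n]_z g z) = fun n =>
    (1 - n.+1%:R^-1) * \int[mu]_z g z + n.+1%:R^-1 * g 0); last first.
    by apply/funext => n; exact: nuE.
  rewrite [X in _ --> X](_ : _ = (1 - 0) * \int[mu]_z g z + 0 * g 0); last first.
    by rewrite subr0 mul1r mul0r addr0.
  apply: cvgD; apply: cvgM; try exact: cvg_cst; last exact: cvg_harmonic.
  by apply: cvgB; [exact: cvg_cst|exact: cvg_harmonic].
- move=> n; apply/invariant_probP => g cg.
  rewrite !nuE//; last exact: circle_mul_comp_continuous.
  rewrite (invariant_probP p mu).1//; congr (_ + _ * g _).
  by rewrite /circle_mul mul0rz.
- apply: nearW => n; rewrite /integral_neq/= nuE// fl.
  rewrite mulrBl mul1r -addrA addrC -subr_eq0 addrK addrC -mulrBr.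
  by rewrite mulf_neq0 ?subr_eq0// invr_neq0// pnatr_eq0.
Qed.

(** The comparison is with the image under [T_(c 1)] and not [T_(c 0)], as the
    recurrence does not constrain [c 0]. *)
Definition recurrent_near (c : nat -> int) f (e : R) (N : nat) : set (circle_prob R) :=
  [set mu | exists2 n, (N <= n)%N &
    `|\int[mu]_z f (circle_mul (c n) z) - \int[mu]_z f (circle_mul (c 1%N) z)| < e].

Lemma recurrent_near_open c f e N : continuous f -> open (recurrent_near c f e N).
Proof.
move=> cf; rewrite (_ : recurrent_near c f e N = \bigcup_(n in [set n | (N <= n)%N])
  [set mu | `|\int[mu]_z f (circle_mul (c n) z) - \int[mu]_z f (circle_mul (c 1%N) z)| < e]).
  apply: bigcup_open => n _.
  apply: (@open_comp _ _ (fun mu : circle_prob R =>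
    `|\int[mu]_z f (circle_mul (c n) z) - \int[mu]_z f (circle_mul (c 1%N) z)| : R)
    [set x | x < e]); last exact: open_lt.
  have ci m := integral_continuous (@circle_mul_comp_continuous _ f (c m) cf).
  by move=> mu _; exact: (cvg_norm (cvgB (ci n mu) (ci 1%N mu))).
by apply/seteqP; split => mu [n nN h]; exists n.
Qed.

(** The approximants are the rounded probabilities along the lengths
    [m * t + 1], for which the repunit [q] is prime to [a L]: modulo [q] the
    recurrence returns to [c 1], so the two integrals are equal, and the bumps
    at the multiples of [1/q] have mass at most [1 / (N + 2)]. *)
Lemma recurrent_small_bumps_dense (p L : nat) (a c : nat -> int) f (e : R) (N : nat) :
  (2 <= p)%N -> (1 <= L)%N -> a L != 0 ->
  (forall n : nat, (L < n)%N ->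
    c n = \sum_(1 <= i < L.+1) a i * c (n - i)%N) ->
  coprimez (a L) p%:Z -> continuous f -> 0 < e ->
  dense (set_val @^-1` (recurrent_near c f e N `&` small_bumps N.+1%:R^-1)
    : set (@invariant_prob R p)).
Proof.
move=> p2 L1 aL0 rec cop cf e0; apply: dense_invariant => mu im.
have aL : (0 < `|a L|)%N by rewrite absz_gt0.
have capL : coprime `|a L|%N p by move: cop; rewrite coprimezE.
pose t := totient (`|a L|%N * p.-1); have t0 : (0 < t)%N.
  by rewrite totient_gt0 muln_gt0 aL; lia.
pose q m := repunit p (m * t).+1.
have q_ge m : (m < q m)%N.
  apply: leq_trans (repunit_ge _ _).
  exact: leq_ltn_trans (leq_pmulr m t0) (ltn_expl _ p2).
pose nu m := orbit_average p (m * t) (rounding (q m) N.+1 mu).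
exists nu; split.
- apply/wstar_cvgP => g; have cg : continuous g by exact: cts_fun.
  apply/cvgrPdist_le => d d0.
  have [k0 hk] := @orbit_average_rounding_dist R p N.+1 mu g d p2 im cg d0.
  exists k0 => // m /= km; rewrite distrC; apply: hk.
  by rewrite (leq_trans km)// leq_pmulr.
- move=> m; apply: orbit_average_invariant => g cg.
  apply: rounding_periodic => //; [exact: leq_ltn_trans (q_ge m)|lia|].
  exact: repunit_dvd.
- exists N.+2 => // m /= Nm; have q1 : (1 < q m)%N by have := q_ge m; lia.
  split.
    have copq : coprimez (a L) (q m)%:Z.
      by rewrite coprimezE/= coprime_sym coprime_repunit.
    have [n nN qn] := linear_recurrence_returns q1 L1 rec copq N.
    exists n => //.
    rewrite (@orbit_average_rounding_eq R p (m * t) (q m) N.+1 mu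
      (fun z => f (circle_mul (c n) z)) (fun z => f (circle_mul (c 1%N) z))).
    + by rewrite subrr normr0.
    + exact: circle_mul_comp_continuous.
    + exact: circle_mul_comp_continuous.
    + move=> j; congr f; rewrite !circle_mul_ratio; apply: circle_proj_ratio_eq.
        exact: ltnW.
      by rewrite -mulrBl dvdz_mulr.
  exists (q m); split; first exact: ltnW.
  move=> j; apply: (@le_lt_trans _ _ N.+2%:R^-1); last first.
    by rewrite ltf_pV2 ?posrE ?ltr0n// ltr_nat.
  apply: integral_bump_le; first exact: coprime_repunit_base.
  by have := q_ge m; lia.
Qed.

End dense_open_sets.

(** * Residuality *)

(** Along the times provided by recurrence the integrals of [f] against the
    images of [mu] tend to the integral of [f \o T_(c 1)], which is not the
    integral against [nu]. *)
Lemma recurrent_not_equidistributed (R : realType) (c : nat -> int)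
    (f : circle R -> R) (mu nu : circle_prob R) : continuous f ->
  \int[mu]_z f (circle_mul (c 1%N) z) != \int[nu]_z f z ->
  (forall N, recurrent_near c f N.+1%:R^-1 N mu) ->
  ~ (times_push (c n) mu @[n --> \oo] --> nu).
Proof.
move=> cf fl rc /wstar_cvgP.
pose F : continuousType (circle R) R := HB.pack f (isContinuous.Build _ _ f cf).
move=> /(_ F) cvgf.
have {}cvgf : \int[times_push (c n) mu]_z f z @[n --> \oo] --> \int[nu]_z f z by exact: cvgf.
set x := \int[mu]_z _ in fl; set l := \int[nu]_z _ in fl cvgf.
pose e := `|x - l| / 2.
have e0 : 0 < e by rewrite divr_gt0// normr_gt0 subr_eq0.
move: cvgf => /cvgrPdist_lt/(_ _ e0)[N0 _ hN0].
pose N := maxn N0 (Num.truncn e^-1).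
have [n nN] := rc N; rewrite -/x => hn.
have := hN0 n (leq_trans (leq_maxl _ _) nN); rewrite /= integral_times_push//.
move: hn; set y := \int[mu]_z _ => hn hy.
have Ne : N.+1%:R^-1 < e.
  rewrite invf_plt ?posrE//; apply: (lt_le_trans (truncnS_gt _)).
  by rewrite ler_nat ltnS leq_maxr.
have := lt_trans hn Ne; move: hy; rewrite /e distrC => h1 h2.
have : `|x - l| < `|x - l|.
  rewrite {1}(_ : x - l = - (y - x) + (y - l)); last by ring.
  rewrite (le_lt_trans (ler_normD _ _))// normrN; move: h1 h2.
  by set s := `|x - l|; lra.
by rewrite ltxx.
Qed.

Theorem theorem1p7 (R : realType) (p : nat) (c : nat -> int) (L : nat)
    (a : nat -> int) :
  (2 <= p)%N ->
  (1 <= L)%N ->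
  a L != 0 ->
  (forall n : nat, (L < n)%N ->
    c n = \sum_(1 <= i < L.+1) a i * c (n - i)%N) ->
  coprimez (a L) p%:Z ->
  residual (@non_equidistributed R p c).
Proof.
move=> p2 L1 aL0 rec cop.
pose f : circle R -> R := circle_norm.
have cf : continuous f := circle_norm_continuous.
pose l := \int[@circle_leb R]_z f z.
pose cf1 := @circle_mul_comp_continuous R f (c 1%N) cf.
pose A n : set (circle_prob R) := if n is N.+1
  then recurrent_near c f N.+1%:R^-1 N `&` small_bumps N.+1%:R^-1
  else integral_neq (fun z => f (circle_mul (c 1%N) z)) l.
pose O n : set (@invariant_prob R p) := set_val @^-1` A n.
have oO n : open (O n).
  exists (A n) => //; case: n => [|N]; first exact: integral_neq_open.
  by apply: openI; [exact: recurrent_near_open|exact: small_bumps_open].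
have dO n : dense (O n).
  case: n => [|N].
    apply: integral_neq_dense => //; rewrite /f /circle_mul mul0rz circle_norm0.
    by rewrite lt_eqF// integral_norm_leb_gt0.
  by apply: (recurrent_small_bumps_dense N p2 L1 aL0 rec cop cf); rewrite invr_gt0.
exists (\bigcap_n O n); split.
- by exists O.
- exact: invariant_prob_Baire.
move=> mu Omu; split.
  by apply: small_bumps_atom_free => N; have [] := Omu N.+1 I.
apply: (@recurrent_not_equidistributed R c f) => //; first exact: (Omu 0%N I).
by move=> N; have [] := Omu N.+1 I.
Qed.
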